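(* Let $f,h,g$ satisfy the standing assumptions (A1)–(A5) of the context, and let $L_h>0$ be the Lipschitz constant of $\nabla h$ in (A2). Suppose in addition that: (1) $f$ is locally Lipschitz continuous on $\mathrm{dom}\,f$, i.e., for any $\bm{x}\in\mathrm{dom}\,f$ there exist a neighborhood $\mathcal{O}$ of $\bm{x}$ and a constant $L_x>0$ such that $|f(\bm{u})-f(\bm{v})|\le L_x\|\bm{u}-\bm{v}\|$ for all $\bm{u},\bm{v}\in\mathcal{O}\cap\mathrm{dom}\,f$; (2) $g$ is continuously differentiable on $\Omega$ with a locally Lipschitz continuous gradient; (3) $\{\bm{x}^k\}$ is a sequence generated by the iVPGSA described in the context, and there exists an integer $K_0>0$ such that $\delta_k=0$ for all $k\ge K_0$; (4) there exist $\underline{\gamma},\overline{\gamma}>0$ such that $\frac{L_h}{2}<\underline{\gamma}\le\overline{\gamma}$ and $\underline{\gamma}I_n\preceq H_k\preceq\overline{\gamma}I_n$ for all $k\ge0$; (5) $\tau>1$, and $\sum_{k=0}^{\infty}\varepsilon_k<+\infty$, $\sum_{k=0}^{\infty}\sqrt{\varepsilon_k}<+\infty$, $\sum_{k=0}^{\infty}\big(\sum_{i=k}^{\infty}\varepsilon_i\big)^{1-\frac1\tau}<+\infty$; (6) the function $\Phi_\tau(\bm{x},t):=F(\bm{x})+\frac{t^\tau}{\tau}$, $(\bm{x},t)\in\mathrm{dom}\,F\times\mathbb{R}_+$, is a KL function with an exponent $\theta_\tau\in[0,1)$. Let $\bm{x}^*$ be the limit of $\{\bm{x}^k\}$ (which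 exists under these hypotheses). Then the following statements hold. (i) If $\theta_\tau=0$, the sequence $\{\bm{x}^k\}$ converges to $\bm{x}^*$ finitely. (ii) If $\theta_\tau\in(0,\frac12]$: (a) for $\varepsilon_k=\varepsilon_0\zeta^k$ with $0<\zeta<1$ and $\varepsilon_0>0$, there exists $\varrho\in(0,1)$ such that $\|\bm{x}^k-\bm{x}^*\|\le\mathcal{O}(\varrho^k)$ for all sufficiently large $k$; (b) for $\varepsilon_k=\frac{\varepsilon_0}{(k+1)^q}$ with $q>\frac{2\tau-1}{\tau-1}$ and $\varepsilon_0>0$, it holds for all sufficiently large $k$ that $$\|\bm{x}^k-\bm{x}^*\|\le\begin{cases}\mathcal{O}\big(k^{-[\frac{\tau-1}{\tau}(q-1)-1]}\big), & \text{if } 1<\tau\le2 \text{ and } q>\frac{2\tau-1}{\tau-1},\\ \mathcal{O}\big(k^{-[\frac{\tau-1}{\tau}(q-1)-1]}\big), & \text{if } \tau>2 \text{ and } \frac{2\tau-1}{\tau-1}<q<\frac{2(\tau-1)}{\tau-2},\\ \mathcal{O}\big(k^{-(\frac q2-1)}\big), & \text{if } \tau>2 \text{ and } q\ge\frac{2(\tau-1)}{\tau-2}.\end{cases}$$ (iii) If $\theta_\tau\in(\frac12,1)$, for all sufficiently large $k$: (a) for $\varepsilon_k=\varepsilon_0\zeta^k$ with $0<\zeta<1$ and $\varepsilon_0>0$, $\|\bm{x}^k-\bm{x}^*\|\le\mathcal{O}\big(k^{-\frac{1-\theta_\tau}{2\theta_\tau-1}}\big)$; (b) for $\varepsilon_k=\frac{\varepsilon_0}{(k+1)^q}$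 with $q>\frac{2\tau-1}{\tau-1}$ and $\varepsilon_0>0$: (b1) if $1<\tau\le2$ and $q>\frac{2\tau-1}{\tau-1}$, or $\tau>2$ and $\frac{2\tau-1}{\tau-1}<q<\frac{2(\tau-1)}{\tau-2}$, then $$\|\bm{x}^k-\bm{x}^*\|\le\begin{cases}\mathcal{O}\big(k^{-(\frac{\tau-1}{\tau}(q-1)-1)}\big), & \text{if } q<\frac{\tau}{\tau-1}\cdot\frac{\theta_\tau}{2\theta_\tau-1}+1,\\ \mathcal{O}\big(k^{-\frac{1-\theta_\tau}{2\theta_\tau-1}}\big), & \text{otherwise};\end{cases}$$ (b2) if $\tau>2$ and $q\ge\frac{2(\tau-1)}{\tau-2}$, then $$\|\bm{x}^k-\bm{x}^*\|\le\begin{cases}\mathcal{O}\big(k^{-(\frac q2-1)}\big), & \text{if } q<\frac{2\theta_\tau}{2\theta_\tau-1},\\ \mathcal{O}\big(k^{-\frac{1-\theta_\tau}{2\theta_\tau-1}}\big), & \text{otherwise}.\end{cases}$$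
   Context: Notation. $\|\cdot\|$ is the Euclidean norm; $I_n$ is the $n\times n$ identity; $\preceq$ is the Loewner order. ''$a_k\le\mathcal{O}(b_k)$ for all sufficiently large $k$'' means there are $C>0$ and $\bar k$ with $a_k\le Cb_k$ for all $k\ge\bar k$. ''Converges finitely'' means $\bm{x}^k=\bm{x}^*$ for all sufficiently large $k$. For a proper closed convex function $f$, $\delta\ge 0$ and $\bm{x}\in\mathrm{dom}\,f$, $\partial_\delta f(\bm{x}):=\{\bm{d}: f(\bm{y})\ge f(\bm{x})+\langle \bm{d},\bm{y}-\bm{x}\rangle-\delta\ \ \forall \bm{y}\in\mathbb{R}^n\}$, and $\partial f=\partial_0 f$. For a general proper closed function $\psi$, $\partial\psi$ is the limiting subdifferential: $\widehat\partial\psi(\bm{x}):=\{\bm{d}:\liminf_{\bm{y}\to\bm{x},\bm{y}\ne\bm{x}}\frac{\psi(\bm{y})-\psi(\bm{x})-\langle\bm{d},\bm{y}-\bm{x}\rangle}{\|\bm{y}-\bm{x}\|}\ge0\}$, and $\partial\psi(\bm{x})$ is the set of limits of $\bm{d}^k\in\widehat\partial\psi(\bm{x}^k)$ with $\bm{x}^k\to\bm{x}$ and $\psi(\bm{x}^k)\to\psi(\bm{x})$. Problem. Consider $\min_{\bm{x}\in\Omega}\frac{f(\bm{x})+h(\bm{x})}{g(\bm{x})}$, where $\Omega:=\{\bm{x}\in\mathbb{R}^n: g(\bm{x})\neq0\}$ is nonempty, and define $F(\bm{x}):=\frac{f(\bm{x})+h(\bm{x})}{g(\bm{x})}$ if $\bm{x}\in\mathrm{dom}\,f\cap\Omega$,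 and $F(\bm{x}):=+\infty$ otherwise. Standing assumptions. (A1) $f:\mathbb{R}^n\to\mathbb{R}\cup\{+\infty\}$ is proper, closed and convex. (A2) $h:\mathbb{R}^n\to\mathbb{R}$ is continuously differentiable (possibly nonconvex) and there is $L_h>0$ with $\|\nabla h(\bm{x})-\nabla h(\bm{y})\|\le L_h\|\bm{x}-\bm{y}\|$ for all $\bm{x},\bm{y}$. (A3) $g:\mathbb{R}^n\to\mathbb{R}$ is continuous, convex, and nonnegative over $\mathrm{dom}\,f$. (A4) $f+h$ is nonnegative on $\mathrm{dom}\,f$, and $f(\bm{x})+h(\bm{x})>0$ when $g(\bm{x})=0$. (A5) $F$ is level-bounded: for every $\alpha\in\mathbb{R}$ the set $\{\bm{x}:F(\bm{x})\le\alpha\}$ is bounded (possibly empty). Algorithm (iVPGSA). Input: $\bm{x}^0\in\Omega\cap\mathrm{dom}\,f$, nonnegative scalars $\{\varepsilon_k\}_{k\ge0}$, symmetric positive definite matrices $\{H_k\}_{k\ge0}\subset\mathbb{R}^{n\times n}$. For each $k=0,1,2,\dots$: set $c_k=\frac{f(\bm{x}^k)+h(\bm{x}^k)}{g(\bm{x}^k)}$ and take any $\bm{y}^k\in\partial g(\bm{x}^k)$; find $\bm{x}^{k+1}\in\Omega\cap\mathrm{dom}\,f$ and an error pair $(\Delta^k,\delta_k)\in\mathbb{R}^n\times[0,\infty)$ such that $$\Delta^k\in\partial_{\delta_k}f(\bm{x}^{k+1})+\nabla h(\bm{x}^k)-c_k\bm{y}^k+H_k(\bm{x}^{k+1}-\bm{x}^k)$$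 and $$\|\Delta^k\|^2+|\langle\Delta^k,\bm{x}^{k+1}-\bm{x}^k\rangle|+\delta_k\le\varepsilon_k\,g(\bm{x}^{k+1}).$$ The generated sequence $\{\bm{x}^k\}_{k\ge 0}$ is infinite. KL exponent. A proper closed function $\psi:\mathbb{R}^N\to\mathbb{R}\cup\{+\infty\}$ has the KL property at $\tilde{\bm{x}}\in\mathrm{dom}\,\partial\psi:=\{\bm{x}:\partial\psi(\bm{x})\ne\emptyset\}$ with an exponent $\theta\in[0,1)$ if there exist $a,\mu,\nu>0$ such that $\mathrm{dist}(0,\partial\psi(\bm{x}))\ge a(\psi(\bm{x})-\psi(\tilde{\bm{x}}))^\theta$ whenever $\bm{x}\in\mathrm{dom}\,\partial\psi$, $\|\bm{x}-\tilde{\bm{x}}\|\le\mu$ and $\psi(\tilde{\bm{x}})<\psi(\bm{x})<\psi(\tilde{\bm{x}})+\nu$. $\psi$ is a KL function with an exponent $\theta$ if this holds, with the same $\theta$, at every $\tilde{\bm{x}}\in\mathrm{dom}\,\partial\psi$. Here $\Phi_\tau$ is regarded as a function on $\mathbb{R}^{n}\times\mathbb{R}$ equal to $+\infty$ outside $\mathrm{dom}\,F\times\mathbb{R}_+$. *)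

(* Defs.v *)
From mathcomp Require Import all_boot all_order all_algebra.
From mathcomp Require Import all_classical all_reals all_analysis.

Set Implicit Arguments.
Unset Strict Implicit.
Unset Printing Implicit Defensive.

Import Order.TTheory GRing.Theory Num.Theory.
Import numFieldNormedType.Exports.

Local Open Scope classical_set_scope.
Local Open Scope ring_scope.

(* R^n is 'rV[R]_n. The norm that the library puts on 'rV[R]_n is the sup norm;
   it is used below only through its topology, its bounded sets and Frechet
   differentiability, none of which depends on the choice of norm. Every
   quantitative estimate uses [enorm]. *)

Definition dot (R : realType) (n : nat) (u v : 'rV[R]_n) : R :=
  \sum_(i < n) u 0 i * v 0 i.

Definition enorm (R : realType) (n : nat) (u : 'rV[R]_n) : R :=
  Num.sqrt (dot u u).

Definition set_dist (R : realType) (n : nat) (x : 'rV[R]_n) (S : set 'rV[R]_n) :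
    \bar R :=
  ereal_inf [set (enorm (x - y))%:E | y in S].

Definition grad (R : realType) (n : nat) (f : 'rV[R]_n -> R) (x : 'rV[R]_n) :
    'rV[R]_n :=
  \row_(i < n) 'd f x (delta_mx 0 i).

Definition posdef (R : realType) (n : nat) (A : 'M[R]_n) : Prop :=
  A^T = A /\ forall v : 'rV[R]_n, v != 0 -> 0 < dot (v *m A) v.

Definition loewner_le (R : realType) (n : nat) (A B : 'M[R]_n) : Prop :=
  forall v : 'rV[R]_n, 0 <= dot (v *m (B - A)) v.

Definition edom (R : realType) (n : nat) (f : 'rV[R]_n -> \bar R) :
    set 'rV[R]_n :=
  [set x | (f x < +oo)%E].

Definition eproper (R : realType) (n : nat) (f : 'rV[R]_n -> \bar R) : Prop :=
  (forall x, f x != -oo%E) /\ edom f !=set0.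

(* At t = 0 and t = 1 this relies on 0 * +oo = 0. *)
Definition econvex (R : realType) (n : nat) (f : 'rV[R]_n -> \bar R) : Prop :=
  forall (x y : 'rV[R]_n) (t : R), 0 <= t <= 1 ->
    (f (t *: x + (1 - t) *: y)%R <= t%:E * f x + (1 - t)%R%:E * f y)%E.

Definition eps_subdiff (R : realType) (n : nat) (delta : R)
    (f : 'rV[R]_n -> \bar R) (x : 'rV[R]_n) : set 'rV[R]_n :=
  [set d | edom f x /\
     forall y : 'rV[R]_n, (f x + (dot d (y - x)%R)%:E - delta%:E <= f y)%E].

(* Both the Frechet and the limiting subdifferential are empty outside the
   domain, as usual. *)
Definition frechet_subdiff (R : realType) (n : nat) (psi : 'rV[R]_n -> \bar R)
    (x : 'rV[R]_n) : set 'rV[R]_n :=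
  [set d | psi x \is a fin_num /\
     (0 <= limf_einf (fun y : 'rV[R]_n =>
              (psi y - psi x - (dot d (y - x)%R)%:E) * ((enorm (y - x)%R)^-1)%R%:E)
            x^')%E].

Definition limiting_subdiff (R : realType) (n : nat)
    (psi : 'rV[R]_n -> \bar R) (x : 'rV[R]_n) : set 'rV[R]_n :=
  [set d | psi x \is a fin_num /\
     exists (xs ds : nat -> 'rV[R]_n),
       [/\ forall k, frechet_subdiff psi (xs k) (ds k),
           xs k @[k --> \oo] --> x,
           psi (xs k) @[k --> \oo] --> psi x
         & ds k @[k --> \oo] --> d]].

Definition dom_subdiff (R : realType) (n : nat) (psi : 'rV[R]_n -> \bar R) :
    set 'rV[R]_n :=
  [set x | limiting_subdiff psi x !=set0].

Definition KL_property_at (R : realType) (n : nat) (psi : 'rV[R]_n -> \bar R)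
    (theta : R) (xt : 'rV[R]_n) : Prop :=
  exists a mu nu : R, [/\ 0 < a, 0 < mu, 0 < nu &
    forall x, dom_subdiff psi x -> enorm (x - xt) <= mu ->
      (psi xt < psi x)%E -> (psi x < psi xt + nu%:E)%E ->
      ((a * (fine (psi x) - fine (psi xt)) `^ theta)%R%:E
         <= set_dist 0 (limiting_subdiff psi x))%E].

Definition KL_function (R : realType) (n : nat) (psi : 'rV[R]_n -> \bar R)
    (theta : R) : Prop :=
  forall xt, dom_subdiff psi xt -> KL_property_at psi theta xt.

Definition Omega (R : realType) (n : nat) (g : 'rV[R]_n -> R) : set 'rV[R]_n :=
  [set x | g x != 0].

Definition objective (R : realType) (n : nat) (f : 'rV[R]_n -> \bar R)
    (h g : 'rV[R]_n -> R) (x : 'rV[R]_n) : \bar R :=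
  if (f x < +oo)%E && (g x != 0)
  then ((f x + (h x)%:E) * ((g x)^-1)%R%:E)%E else +oo%E.

(* R^n x R is 'rV[R]_(n + 1), so that [enorm] is its Euclidean norm; the last
   coordinate is t. *)
Definition Phi (R : realType) (n : nat) (f : 'rV[R]_n -> \bar R)
    (h g : 'rV[R]_n -> R) (tau : R) (z : 'rV[R]_(n + 1)) : \bar R :=
  let x := lsubmx z in let t := rsubmx z 0 0 in
  if 0 <= t then (objective f h g x + (t `^ tau / tau)%R%:E)%E else +oo%E.

Record standing_assumptions (R : realType) (n : nat)
    (f : 'rV[R]_n -> \bar R) (h g : 'rV[R]_n -> R) (Lh : R) : Prop := {
  f_proper : eproper f;
  f_closed : lower_semicontinuous f;
  f_convex : econvex f;
  h_differentiable : forall x : 'rV[R]_n, differentiable h x;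
  h_grad_continuous : continuous (grad h);
  Lh_gt0 : 0 < Lh;
  h_grad_lipschitz : forall x y,
    enorm (grad h x - grad h y) <= Lh * enorm (x - y);
  g_continuous : continuous g;
  g_convex : convex_function [set: 'rV[R]_n] g;
  g_ge0 : forall x, edom f x -> 0 <= g x;
  fh_ge0 : forall x, edom f x -> (0 <= f x + (h x)%:E)%E;
  fh_gt0 : forall x, g x = 0 -> (0 < f x + (h x)%:E)%E;
  Omega_nonempty : Omega g !=set0;
  objective_level_bounded : forall alpha : R,
    bounded_set [set x | (objective f h g x <= alpha%:E)%E]
}.

Record iVPGSA (R : realType) (n : nat) (f : 'rV[R]_n -> \bar R)
    (h g : 'rV[R]_n -> R) (eps : nat -> R) (H : nat -> 'M[R]_n)
    (x y Delta : nat -> 'rV[R]_n) (delta : nat -> R) : Prop := {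
  eps_ge0 : forall k, 0 <= eps k;
  H_posdef : forall k, posdef (H k);
  x_feasible : forall k, Omega g (x k) /\ edom f (x k);
  y_subgradient : forall k, eps_subdiff 0 (fun u => (g u)%:E) (x k) (y k);
  delta_ge0 : forall k, 0 <= delta k;
  x_step : forall k,
    let c := (fine (f (x k)) + h (x k)) / g (x k) in
    exists2 d, eps_subdiff (delta k) f (x k.+1) d &
      Delta k = d + grad h (x k) - c *: y k + (x k.+1 - x k) *m (H k)^T;
  x_error : forall k,
    enorm (Delta k) ^+ 2 + `|dot (Delta k) (x k.+1 - x k)| + delta k
      <= eps k * g (x k.+1)
}.

Definition eventually_O (R : realType) (a b : nat -> R) : Prop :=
  exists2 C : R, 0 < C & \forall k \near \oo, a k <= C * b k.

(* Main.v *)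
Require Import Defs.
From mathcomp Require Import all_boot all_order all_algebra.
From mathcomp Require Import all_classical all_reals all_analysis.
From mathcomp Require Import ring lra.

(** Write [c k] for the quotient [F (x k)] and [s k = x k.+1 - x k]. The
    subgradient inequalities for [f] and [g] and the quadratic upper bound on [h]
    give the inexact descent ([run_descent])
      [c k.+1 + (gam_lo - Lh / 2) * |s k| ^ 2 / g (x k.+1) <= c k + eps k].
    If [r k] majorizes the tail of the series of errors from [k] on, then
    [c k + r k] is nonincreasing; it is the value of the potential
    [Phi (x, t) = F x + t ^ tau / tau] at the point [(x k, t k)], where
    [t k = (tau * r k) ^ (1 / tau)]. Level-boundedness yields a cluster point
    [xs]. Since [f] is closed and [f + h] is positive on the zero set of [g],
    [xs] is feasible and [c k + r k] tends to [F xs] ([run_cluster_point]).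

    Near [xs] the quotient rule, applied to the inexact optimality condition of
    the subproblem, produces a subgradient of [Phi] at [(x k.+1, t k.+1)] of norm
    at most [C * (|s k| + e k)], where
      [e k = sqrt (eps k) + r k.+1 ^ (1 - 1 / tau)]
    ([run_subgradient_bound]). Hence [(xs, 0)] is a critical point, where the KL
    inequality holds, and the gap [A k = c k + r k - F xs] satisfies
      [A k.+1 + sigma * |s k| ^ 2 <= A k],
      [A k.+1 ^ theta <= C * (|s k| + e k)]
    as long as the iterates stay near [xs] ([run_kl_descent]). The rest concerns
    real sequences only. Concavity of [t ^ (1 - theta)] turns the two
    inequalities into a telescoping bound on the steps, so that the iterates
    never leave the neighbourhood once they are close enough to [xs], and
      [|x k.+1 - xs| <= |s k| + E k + C' * A k.+1 ^ (1 - theta)],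
    where [E k] majorizes the tail of the series of the [e k] ([kl_engine]). In
    particular [x k] converges to [xs].

    For the rates, eliminating the step leaves the recursion
      [A k.+1 + al * A k.+1 ^ (2 * theta) <= A k + sigma * e k ^ 2].
    With [theta = 1 / 2] and geometric errors it gives geometric decay. All
    polynomial rates come from one case: if [theta = p / (2 * p - 1)] with
    [1 < p] and [e k = O (k ^ (- p))], then [A k = O (k ^ (- (2 * p - 1)))] and
    [|x k - xs| = O (k ^ (- (p - 1)))] ([kl_poly_rate]). Indeed the KL exponent
    may be increased and the decay of the errors weakened until they match, so
    the rate is [p - 1], where [p] is the smaller of the decay exponent of [e k]
    and, if [1 / 2 < theta], of [theta / (2 * theta - 1)]. For [theta = 0] a
    positive gap cannot tend to zero, so the gap vanishes eventually and the
    iterates stop moving ([kl_finite]).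

    The sequences [r] and [E] are left free throughout: the tails of the series
    serve to prove convergence, explicit majorants to prove the rates. *)

Import Order.TTheory GRing.Theory Num.Theory.
Import numFieldNormedType.Exports.

Local Open Scope classical_set_scope.
Local Open Scope ring_scope.

Set Implicit Arguments.
Unset Strict Implicit.
Unset Printing Implicit Defensive.

(** * The Euclidean structure of row vectors *)

Lemma dotC (R : realType) n (u v : 'rV[R]_n) : dot u v = dot v u.
Proof. by apply: eq_bigr => i _; rewrite mulrC. Qed.

Lemma dotDl (R : realType) n (u v w : 'rV[R]_n) :
  dot (u + v) w = dot u w + dot v w.
Proof. by rewrite -big_split; apply: eq_bigr => i _; rewrite mxE mulrDl. Qed.

Lemma dotZl (R : realType) n a (u w : 'rV[R]_n) : dot (a *: u) w = a * dot u w.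
Proof. by rewrite mulr_sumr; apply: eq_bigr => i _; rewrite mxE mulrA. Qed.

Lemma dotDr (R : realType) n (u v w : 'rV[R]_n) :
  dot w (u + v) = dot w u + dot w v.
Proof. by rewrite dotC dotDl !(dotC w). Qed.

Lemma dotZr (R : realType) n a (u w : 'rV[R]_n) : dot w (a *: u) = a * dot w u.
Proof. by rewrite dotC dotZl dotC. Qed.

Lemma dotNl (R : realType) n (u w : 'rV[R]_n) : dot (- u) w = - dot u w.
Proof. by rewrite -scaleN1r dotZl mulN1r. Qed.

Lemma dotNr (R : realType) n (u w : 'rV[R]_n) : dot w (- u) = - dot w u.
Proof. by rewrite -scaleN1r dotZr mulN1r. Qed.

Lemma dotBl (R : realType) n (u v w : 'rV[R]_n) :
  dot (u - v) w = dot u w - dot v w.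
Proof. by rewrite dotDl dotNl. Qed.

Lemma dot0l (R : realType) n (w : 'rV[R]_n) : dot 0 w = 0.
Proof. by rewrite -(scale0r 0) dotZl mul0r. Qed.

Lemma dot_ge0 (R : realType) n (u : 'rV[R]_n) : 0 <= dot u u.
Proof. by apply: sumr_ge0 => i _; rewrite -expr2 sqr_ge0. Qed.

Lemma enorm_ge0 (R : realType) n (u : 'rV[R]_n) : 0 <= enorm u.
Proof. exact: sqrtr_ge0. Qed.

Lemma enorm_sqr (R : realType) n (u : 'rV[R]_n) : enorm u ^+ 2 = dot u u.
Proof. by rewrite sqr_sqrtr ?dot_ge0. Qed.

Lemma enorm0 (R : realType) n : enorm (0 : 'rV[R]_n) = 0.
Proof. by rewrite /enorm dot0l sqrtr0. Qed.

Lemma enorm0_eq0 (R : realType) n (u : 'rV[R]_n) : enorm u = 0 -> u = 0.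
Proof.
move=> u0; have /eqP : dot u u = 0 by rewrite -enorm_sqr u0 expr0n.
rewrite psumr_eq0; last by move=> i _; rewrite -expr2 sqr_ge0.
move=> /allP h; apply/rowP => i; rewrite mxE.
by have := h i (mem_index_enum i); rewrite -expr2 sqrf_eq0 => /eqP.
Qed.

Lemma enormZ (R : realType) n a (u : 'rV[R]_n) : enorm (a *: u) = `|a| * enorm u.
Proof.
by rewrite /enorm dotZl dotZr mulrA -expr2 sqrtrM ?sqr_ge0// sqrtr_sqr.
Qed.

Lemma enormN (R : realType) n (u : 'rV[R]_n) : enorm (- u) = enorm u.
Proof. by rewrite -scaleN1r enormZ normrN1 mul1r. Qed.

Lemma enormB (R : realType) n (u v : 'rV[R]_n) : enorm (u - v) = enorm (v - u).
Proof. by rewrite -opprB enormN. Qed.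

(** Cauchy-Schwarz for a positive semidefinite form whose values at [(u, u)],
    [(u, v)] and [(v, v)] are [a], [b] and [c]: the hypothesis is that the form is
    nonnegative at every [s u + t v]. *)
Lemma psd_CS (R : realType) (a b c : R) : 0 <= a -> 0 <= c ->
  (forall s t, 0 <= s ^+ 2 * a + 2 * s * t * b + t ^+ 2 * c) -> b ^+ 2 <= a * c.
Proof.
move=> a0 c0 h.
have [a00|an0] := eqVneq a 0.
  have [->|bn0] := eqVneq b 0; first by rewrite expr0n mulr_ge0.
  have := h (- (c + 1) / (2 * b)) 1; rewrite a00.
  have -> : (- (c + 1) / (2 * b)) ^+ 2 * 0
    + 2 * (- (c + 1) / (2 * b)) * 1 * b + 1 ^+ 2 * c = - 1 by field.
  by rewrite oppr_ge0 ler10.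
have ap : 0 < a by rewrite lt_def an0.
have := h (- b) a.
have -> : (- b) ^+ 2 * a + 2 * - b * a * b + a ^+ 2 * c = a * (a * c - b ^+ 2).
  by ring.
by rewrite pmulr_rge0// subr_ge0.
Qed.

Lemma dot_le (R : realType) n (u v : 'rV[R]_n) : `|dot u v| <= enorm u * enorm v.
Proof.
rewrite -(@ler_pXn2r _ 2)// ?nnegrE ?mulr_ge0 ?enorm_ge0//.
rewrite -normrX ger0_norm ?sqr_ge0// exprMn !enorm_sqr.
apply: psd_CS; rewrite ?dot_ge0// => s t.
have := dot_ge0 (s *: u + t *: v).
rewrite !(dotDl, dotDr, dotZl, dotZr) (dotC v u).
by congr (_ <= _); ring.
Qed.

Lemma enormD (R : realType) n (u v : 'rV[R]_n) :
  enorm (u + v) <= enorm u + enorm v.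
Proof.
rewrite -(@ler_pXn2r _ 2)// ?nnegrE ?addr_ge0 ?enorm_ge0//.
rewrite sqrrD !enorm_sqr dotDl !dotDr (dotC v u).
have := le_trans (ler_norm _) (dot_le u v).
rewrite mulr2n; lra.
Qed.

Lemma enorm_triangle (R : realType) n (u v w : 'rV[R]_n) :
  enorm (u - w) <= enorm (u - v) + enorm (v - w).
Proof. by rewrite -(subrKA v u (- w)) -addrA addrA; exact: enormD. Qed.

Lemma enorm_coord (R : realType) n (u : 'rV[R]_n) i : `|u 0 i| <= enorm u.
Proof.
rewrite -sqrtr_sqr ler_wsqrtr// /dot (bigD1 i)//= -expr2 lerDl.
by apply: sumr_ge0 => j _; rewrite -expr2 sqr_ge0.
Qed.

(** The library norm on row vectors is the sup norm; these two bounds say that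
    it is equivalent to the Euclidean one. *)
Lemma mx_norm_le_enorm (R : realType) n (u : 'rV[R]_n) : `|u| <= enorm u.
Proof.
rewrite [leLHS]/Num.Def.normr /= mx_normrE bigmax_le ?enorm_ge0// => -[i j] _ /=.
by rewrite (ord1 i) enorm_coord.
Qed.

Lemma enorm_le_mx_norm (R : realType) n (u : 'rV[R]_n) :
  enorm u <= n%:R * `|u|.
Proof.
have le_coord i : `|u 0 i| <= `|u|.
  rewrite [leRHS]/Num.Def.normr /= mx_normrE.
  exact: (le_bigmax _ (fun ij => `|u ij.1 ij.2|) (0, i)).
rewrite -(@ler_pXn2r _ 2)// ?nnegrE ?mulr_ge0 ?enorm_ge0//.
rewrite enorm_sqr (@le_trans _ _ (\sum_(i < n) `|u| ^+ 2))//.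
  apply: ler_sum => i _; rewrite -expr2 -real_normK ?num_real//.
  by rewrite ler_pXn2r ?nnegrE.
rewrite sumr_const card_ord exprMn -[leLHS]mulr_natl.
apply: ler_wpM2r; first exact: sqr_ge0.
by rewrite -natrX ler_nat; case: (n) => // m; rewrite leq_pmulr.
Qed.

(** Euclidean balls form a basis of neighbourhoods. *)
Lemma nbhs_enormP (R : realType) n (x : 'rV[R]_n) (A : set 'rV[R]_n) :
  nbhs x A <-> exists2 r : R, 0 < r & forall y, enorm (y - x) < r -> A y.
Proof.
split=> [/nbhs_ballP [r /= r0 rA]|[r r0 rA]].
  exists r => // y yx; apply: rA; rewrite -ball_normE /ball_ /= distrC.
  exact: le_lt_trans (mx_norm_le_enorm _) yx.
apply/nbhs_ballP; exists (r / n.+1%:R) => /=; first by rewrite divr_gt0.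
move=> y; rewrite -ball_normE /ball_ /= distrC => yx; apply: rA.
apply: le_lt_trans (enorm_le_mx_norm _) _.
rewrite ltr_pdivlMr// in yx; apply: le_lt_trans yx.
by rewrite mulrC ler_wpM2l// ler_nat.
Qed.

Lemma cvg_enorm (R : realType) n (u : nat -> 'rV[R]_n) (l : 'rV[R]_n) :
  (forall e : R, 0 < e -> \forall k \near \oo, enorm (u k - l) < e) ->
  u k @[k --> \oo] --> l.
Proof.
move=> h A /nbhs_enormP [r r0 rA].
by have := h _ r0; apply: filterS => k /rA.
Qed.

Lemma enorm_cvg0 (R : realType) n (u : nat -> 'rV[R]_n) (l : 'rV[R]_n) (b : nat -> R) :
  (forall j, enorm (u j - l) <= b j) -> b j @[j --> \oo] --> 0 -> u j @[j --> \oo] --> l.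
Proof.
move=> ub bc; apply: cvg_enorm => d d0.
have /cvgr0Pnorm_lt/(_ _ d0) := bc; apply: filterS => j.
by move=> /(le_lt_trans (ler_norm _)); exact: le_lt_trans.
Qed.

Lemma norm_ball_compact (R : realType) n (B : R) : compact [set z : 'rV[R]_n | `|z| <= B].
Proof.
apply: bounded_closed_compact.
  exists B; split; first exact: num_real.
  by move=> M BM z /= /le_trans; apply; exact: ltW.
apply: (preimage_closed _ (@closed_le _ B)) => z _.
exact: norm_continuous.
Qed.

Lemma dot_row_mx (R : realType) n m (u u' : 'rV[R]_n) (v v' : 'rV[R]_m) :
  dot (row_mx u v) (row_mx u' v') = dot u u' + dot v v'.
Proof.
rewrite /dot big_split_ord /=.
by congr (_ + _); apply: eq_bigr => i _; rewrite ?row_mxEl ?row_mxEr.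
Qed.

(** * Gradients *)

(** The differential is the scalar product with the gradient. *)
Lemma diff_grad (R : realType) n (f : 'rV[R]_n -> R) (x v : 'rV[R]_n) :
  'd f x v = dot (grad f x) v.
Proof.
rewrite {1}(row_sum_delta v) linear_sum; apply: eq_bigr => i _.
by rewrite linearZ /= mxE mulrC.
Qed.

(** First-order expansion, in the Euclidean norm. *)
Lemma differentiable_approx (R : realType) n (f : 'rV[R]_n -> R) (x : 'rV[R]_n) :
  differentiable f x -> forall e : R, 0 < e ->
  exists2 r : R, 0 < r & forall y, enorm (y - x) < r ->
    `|f y - f x - dot (grad f x) (y - x)| <= e * enorm (y - x).
Proof.
move=> /diff_locally /eqaddoP fo e e0.
have [r r0 H] := (nbhs_enormP _ _).1 (fo _ e0).
exists r => // y yx; have := H (y - x).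
rewrite subr0 => /(_ yx).
rewrite -[_ (y - x)]/(f (y - x + x) - (f x + 'd f x (y - x))).
rewrite subrK diff_grad opprD addrA => /le_trans; apply.
by rewrite ler_wpM2l ?(ltW e0) ?mx_norm_le_enorm.
Qed.

(** A convex subgradient at a point of differentiability is the gradient. *)
Lemma subgradient_grad (R : realType) n (g : 'rV[R]_n -> R) (x y : 'rV[R]_n) :
  differentiable g x -> eps_subdiff 0 (fun u => (g u)%:E) x y -> y = grad g x.
Proof.
move=> gx [_ sub]; apply/eqP; rewrite -subr_eq0; apply/eqP/enorm0_eq0.
set w := y - grad g x; apply/eqP; rewrite eq_le enorm_ge0 andbT.
apply/ler_addgt0Pl => e e0; rewrite addr0.
have [w0|wn0] := eqVneq (enorm w) 0; first by rewrite w0 ltW.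
have wp : 0 < enorm w by rewrite lt_def wn0 enorm_ge0.
have [r r0 H] := differentiable_approx gx e0.
(* Move in the direction [w] by half the radius on which [g] is close to its
   linear approximation. *)
pose t := r / 2 / enorm w.
have t0 : 0 < t by rewrite !divr_gt0.
have := H (x + t *: w); rewrite addrC addKr enormZ gtr0_norm//.
have tw : t * enorm w = r / 2 by rewrite /t divfK.
rewrite {1}tw ltr_pdivrMr// ltr_pMr// ltr1n => /(_ isT).
move=> /(le_trans (ler_norm _)).
have := sub (x + t *: w); rewrite sube0 -EFinD lee_fin.
rewrite [x + _ - x]addrC addKr !dotZr => h1 h2.
have : t * (enorm w * enorm w) <= t * (e * enorm w).
  rewrite -expr2 enorm_sqr {1}/w dotBl mulrBr; lra.
by rewrite ler_pM2l// ler_pM2r.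
Qed.

Lemma is_derive_line (R : realType) n (h : 'rV[R]_n -> R) (u s : 'rV[R]_n) (t : R) :
  differentiable h (u + t *: s) ->
  is_derive t (1 : R) (fun t => h (u + t *: s)) (dot (grad h (u + t *: s)) s).
Proof.
move=> dh.
have dl : is_diff t (fun t : R => u + t *: s) (fun r => r *: s).
  by apply: is_diff_eq; rewrite add0r.
have -> : (fun t => h (u + t *: s)) = h \o (fun t : R => u + t *: s) by [].
have dc : differentiable (h \o (fun t : R => u + t *: s)) t.
  exact: differentiable_comp.
apply: DeriveDef; first exact: diff_derivable.
by rewrite deriveE// diff_comp//= diff_val scale1r diff_grad.
Qed.

(** Quadratic upper bound for a function with an [L]-Lipschitz gradient. *)
Lemma descent_lemma (R : realType) n (h : 'rV[R]_n -> R) (L : R) :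
  (forall x : 'rV[R]_n, differentiable h x) ->
  (forall x y, enorm (grad h x - grad h y) <= L * enorm (x - y)) ->
  forall u v, h v - h u <= dot (grad h u) (v - u) + L / 2 * enorm (v - u) ^+ 2.
Proof.
move=> dh lip u v; set s := v - u.
pose psi := fun t : R => h (u + t *: s) - L / 2 * enorm s ^+ 2 * t ^+ 2.
pose dpsi := fun t : R => dot (grad h (u + t *: s)) s - L * enorm s ^+ 2 * t.
have psid (t : R) : is_derive t (1 : R) psi (dpsi t).
  have := is_derive_line (dh (u + t *: s)) => ?.
  apply: is_derive_eq; rewrite /dpsi /= !scaler1 /GRing.scale /=.
  by rewrite mulr2n; field.
have [|c] := @MVT R psi dpsi 0 1 ltr01.
  apply: derivable_within_continuous => t _; exact: ex_derive.
rewrite in_itv /= => /andP[c0 c1]; rewrite /psi /dpsi scale1r scale0r addr0 subr0 mulr1.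
rewrite expr0n mulr0 subr0 expr1n mulr1 {1}/s subrKC => E.
have : dot (grad h (u + c *: s) - grad h u) s <= L * c * enorm s ^+ 2.
  apply: le_trans (ler_norm _) _; apply: le_trans (dot_le _ _) _.
  rewrite expr2 mulrA ler_wpM2r ?enorm_ge0//.
  apply: le_trans (lip _ _) _; rewrite [u + _]addrC addrK enormZ gtr0_norm//.
  by rewrite mulrA.
have aux (a b N hv hu : R) : hv - L / 2 * N - hu = a - L * N * c ->
    a - b <= L * c * N -> hv - hu <= b + L / 2 * N by lra.
by rewrite dotBl; apply: aux.
Qed.

(** * Subgradients of the potential function *)

(** Sufficient condition for a Frechet subgradient, without limits inferior. *)
Lemma frechet_subdiff_approx (R : realType) n (psi : 'rV[R]_n -> \bar R)
    (x d : 'rV[R]_n) : psi x \is a fin_num ->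
  (forall e : R, 0 < e -> exists2 r : R, 0 < r & forall y, enorm (y - x) < r ->
     ((fine (psi x) + dot d (y - x) - e * enorm (y - x))%:E <= psi y)%E) ->
  frechet_subdiff psi x d.
Proof.
move=> fx H; split => //; rewrite limf_einfE; apply/lee_addgt0Pr => e e0.
have [r r0 rP] := H e e0.
rewrite -leeBlDr// sub0e.
pose V : set 'rV[R]_n := [set y | enorm (y - x) < r /\ y != x].
apply: (@le_trans _ _ (ereal_inf ((fun y : 'rV[R]_n =>
  (psi y - psi x - (dot d (y - x))%:E) * (enorm (y - x))^-1%:E)%E @` V))).
  apply: le_ereal_inf_tmp => _ [y [yr yx] <-].
  have np : 0 < enorm (y - x).
    rewrite lt_def enorm_ge0 andbT; apply/eqP => /enorm0_eq0/eqP.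
    by rewrite subr_eq0 (negbTE yx).
  have := rP _ yr; move: fx; case: (psi x) => //= a _.
  case: (psi y) => [b||] //=; last by move=> _; rewrite gt0_mulye ?leey// lte_fin invr_gt0.
  rewrite -!EFinB -EFinM !lee_fin => h.
  by rewrite ler_pdivlMr//; lra.
apply: ereal_sup_ubound => /=; exists V => //.
rewrite /dnbhs /within /=; near=> y => yx; split => //; near: y.
by apply/nbhs_enormP; exists r.
Unshelve. all: by end_near. Qed.

Lemma frechet_limiting (R : realType) n (psi : 'rV[R]_n -> \bar R)
    (x d : 'rV[R]_n) : frechet_subdiff psi x d -> limiting_subdiff psi x d.
Proof.
move=> xd; split; first by case: xd.
by exists (fun=> x), (fun=> d); split => //; exact: cvg_cst.
Qed.

(** Tangent-line inequality for the convex function [t ^ tau / tau] on the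
    nonnegative reals; this is Young's inequality. *)
Lemma powR_tangent (R : realType) (tau s t : R) : 1 < tau -> 0 <= s -> 0 <= t ->
  t `^ tau / tau + t `^ (tau - 1) * (s - t) <= s `^ tau / tau.
Proof.
move=> tau1 s0 t0; have tau0 : 0 < tau by lra.
have q0 : 0 < tau / (tau - 1) by rewrite divr_gt0//; lra.
have := @conjugate_powR R s (t `^ (tau - 1)) tau (tau / (tau - 1)) s0 (powR_ge0 _ _).
have -> : tau^-1 + (tau / (tau - 1))^-1 = 1 by field; apply/andP; split; lra.
rewrite -powRrM mulrCA divff ?subr_eq0 ?gt_eqF// mulr1.
move=> /(_ tau0 q0 erefl) h.
have : t `^ (tau - 1) * t = t `^ tau by rewrite mulrC mulr_powRB1.
have E : t `^ tau / (tau / (tau - 1)) = t `^ tau - t `^ tau / tau.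
  by field; apply/andP; split; lra.
rewrite E in h; rewrite mulrBr; lra.
Qed.

(** The quadratic upper bound at [v], together with the Lipschitz bound, gives a
    quadratic lower bound at [u]. *)
Lemma quadratic_lower (R : realType) n (h : 'rV[R]_n -> R) (dh : 'rV[R]_n -> 'rV[R]_n)
    (L : R) :
  (forall u v, h v - h u <= dot (dh u) (v - u) + L / 2 * enorm (v - u) ^+ 2) ->
  (forall u v, enorm (dh u - dh v) <= L * enorm (u - v)) ->
  forall u v, h u + dot (dh u) (v - u) - 3 / 2 * L * enorm (v - u) ^+ 2 <= h v.
Proof.
move=> up lip u v; have := up v u.
have : dot (dh u - dh v) (v - u) <= L * enorm (v - u) ^+ 2.
  apply: le_trans (ler_norm _) _; apply: le_trans (dot_le _ _) _.
  by rewrite expr2 mulrA ler_wpM2r ?enorm_ge0// (enormB v u) lip.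
rewrite (dotBl (dh u)) (enormB u) -(opprB v u) (dotNr (v - u) (dh v)); lra.
Qed.

Section potential.
Variables (R : realType) (n : nat) (f : 'rV[R]_n -> \bar R) (h g : 'rV[R]_n -> R).
Variable (Lh : R).
Hypothesis hA : standing_assumptions f h g Lh.

Lemma f_fin (x : 'rV[R]_n) : edom f x -> f x = (fine (f x))%:E.
Proof.
move=> fx; rewrite fineK// fin_numE (f_proper hA).1 /=.
by apply/eqP => E; move: fx; rewrite /edom /= E.
Qed.

Lemma g_gt0 (x : 'rV[R]_n) : Omega g x -> edom f x -> 0 < g x.
Proof. by move=> gx fx; rewrite lt_def gx (g_ge0 hA). Qed.

(** The value of the quotient at a feasible point, as a real number. *)
Definition Fval (x : 'rV[R]_n) : R := (fine (f x) + h x) / g x.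

Lemma objectiveE (x : 'rV[R]_n) : Omega g x -> edom f x ->
  objective f h g x = (Fval x)%:E.
Proof.
by move=> gx fx; rewrite /objective fx gx /= {1}(f_fin fx).
Qed.

Lemma Fval_ge0 (x : 'rV[R]_n) : Omega g x -> edom f x -> 0 <= Fval x.
Proof.
move=> gx fx; rewrite /Fval divr_ge0 ?(ltW (g_gt0 _ _))//.
by rewrite -lee_fin EFinD -f_fin// (fh_ge0 hA).
Qed.

(** A point of [R^n x R], which is encoded as a row vector of size [n + 1]. *)
Definition pt (x : 'rV[R]_n) (t : R) : 'rV[R]_(n + 1) := row_mx x t%:M.

Lemma pt_split (z : 'rV[R]_(n + 1)) : z = pt (lsubmx z) (rsubmx z 0 0).
Proof. by rewrite /pt -mx11_scalar hsubmxK. Qed.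

Lemma ptB x t x' t' : pt x t - pt x' t' = pt (x - x') (t - t').
Proof. by rewrite /pt opp_row_mx add_row_mx raddfB. Qed.

Lemma dot_scalar (s t : R) : dot s%:M t%:M = s * t.
Proof. by rewrite /dot big_ord1 !mxE eqxx. Qed.

Lemma dot_pt x t x' t' : dot (pt x t) (pt x' t') = dot x x' + t * t'.
Proof. by rewrite dot_row_mx dot_scalar. Qed.

Lemma enorm_pt_ge x t : enorm x <= enorm (pt x t).
Proof.
by rewrite ler_wsqrtr// dot_pt lerDl -expr2 sqr_ge0.
Qed.

Lemma enorm_pt_le x t : enorm (pt x t) <= enorm x + `|t|.
Proof.
rewrite -(@ler_pXn2r _ 2)// ?nnegrE ?addr_ge0 ?enorm_ge0//.
rewrite enorm_sqr dot_pt sqrrD enorm_sqr real_normK ?num_real// -expr2.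
by rewrite lerD2r lerDl mulrn_wge0 ?mulr_ge0 ?enorm_ge0.
Qed.

Lemma PhiE tau (x : 'rV[R]_n) t : Phi f h g tau (pt x t) =
  if 0 <= t then (objective f h g x + (t `^ tau / tau)%:E)%E else +oo%E.
Proof.
by rewrite /Phi /pt row_mxKl row_mxKr mxE eqxx.
Qed.

Lemma Phi_fin tau (x : 'rV[R]_n) t : Omega g x -> edom f x -> 0 <= t ->
  Phi f h g tau (pt x t) = (Fval x + t `^ tau / tau)%:E.
Proof. by move=> gx fx t0; rewrite PhiE t0 objectiveE. Qed.

(** First-order lower bound on the quotient: a subgradient of [f] at [x] yields
    the subgradient of the quotient given by the quotient rule. *)
Lemma Fval_lower (x d : 'rV[R]_n) : Omega g x -> differentiable g x ->
  eps_subdiff 0 f x d -> forall e : R, 0 < e ->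
  exists2 r : R, 0 < r & forall y, enorm (y - x) < r -> Omega g y -> edom f y ->
    Fval x + dot ((g x)^-1 *: (d + grad h x - Fval x *: grad g x)) (y - x)
      - e * enorm (y - x) <= Fval y.
Proof.
move=> gx dg [fx sub] e e0.
have gx0 := g_gt0 gx fx.
have c0 := Fval_ge0 gx fx.
have hlow := quadratic_lower
  (descent_lemma (h_differentiable hA) (h_grad_lipschitz hA)) (h_grad_lipschitz hA).
have gapp := differentiable_approx dg.
(* The gradients are generalized, so that only their properties matter. *)
move: (grad h) (grad g) hlow gapp => dh dgr hlow gapp.
set c := Fval x in c0 *; set w := d + dh x - c *: dgr x.
(* [e1] bounds the first-order errors of [h] and [g] in the numerator; [e2]
   bounds the variation of the denominator, with [b] a bound on [w]. *)
pose e1 := e * g x / 8.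
have e10 : 0 < e1 by rewrite !mulr_gt0 ?invr_gt0.
have c1 : 0 < c + 1 by lra.
have [r1 r10 H1] := gapp _ (divr_gt0 e10 c1).
pose b := enorm w + 1; have b0 : 0 < b by rewrite ltr_wpDl ?enorm_ge0.
pose e2 := e * g x ^+ 2 / (4 * b).
have e20 : 0 < e2 by rewrite !mulr_gt0 ?invr_gt0 ?exprn_gt0 ?mulr_gt0.
have Lh0 := Lh_gt0 hA.
pose e3 := Num.min (g x / 2) e2.
have e30 : 0 < e3 by rewrite lt_min e20 divr_gt0.
have [r2 r20 H2] : exists2 r : R, 0 < r &
    forall y, enorm (y - x) < r -> `|g x - g y| < e3.
  apply/(nbhs_enormP x (fun y => `|g x - g y| < e3)).
  by have /cvgr_dist_lt := @g_continuous _ _ _ _ _ _ hA x; apply.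
pose r3 := e1 / (3 / 2 * Lh).
have r30 : 0 < r3 by rewrite divr_gt0 ?mulr_gt0.
exists (Num.min r1 (Num.min r2 r3)); first by rewrite !lt_min r10 r20.
move=> y; rewrite !lt_min => /and3P[yr1 yr2 yr3] gy fy.
have gy0 := g_gt0 gy fy.
have {}H1 := H1 _ yr1; have {}H2 := H2 _ yr2.
have := H2; rewrite lt_min => /andP[H2a H2b].
set N := enorm (y - x) in H1 yr1 yr2 yr3 *.
have N0 : 0 <= N by exact: enorm_ge0.
have sf : fine (f x) + dot d (y - x) <= fine (f y).
  by have := sub y; rewrite (f_fin fx) (f_fin fy) sube0 -EFinD lee_fin.
have hl := hlow x y; rewrite -/N in hl.
have hN : 3 / 2 * Lh * N ^+ 2 <= e1 * N.
  rewrite expr2 mulrA ler_wpM2r// mulrC -ler_pdivlMr ?mulr_gt0//; exact: ltW.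
have cg : c * (g y - g x - dot (dgr x) (y - x)) <= e1 * N.
  have : c * (g y - g x - dot (dgr x) (y - x)) <= c * (e1 / (c + 1) * N).
    by rewrite ler_wpM2l// (le_trans (ler_norm _)).
  move/le_trans; apply; rewrite [c * _]mulrA ler_wpM2r// [c * _]mulrA.
  by rewrite ler_pdivrMr//; lra.
have num : c * g y + dot w (y - x) - 2 * e1 * N <= fine (f y) + h y.
  have E : fine (f x) + h x = c * g x by rewrite /c /Fval divfK.
  rewrite /w dotBl dotDl dotZl; lra.
have dw : `|dot w (y - x)| <= b * N.
  apply: le_trans (dot_le _ _) _; rewrite ler_wpM2r// /b; lra.
have gy2 : g x / 2 < g y by move: H2a; rewrite ltr_norml => /andP[]; lra.
rewrite /Fval ler_pdivlMr// dotZl.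
set D := dot w (y - x) in num dw *.
have E2 : e2 / g x * b = e * g x / 4 by rewrite /e2; field; rewrite !gt_eqF.
have key : D * (g y / g x - 1) <= e2 / g x * (b * N).
  apply: le_trans (ler_norm _) _; rewrite normrM mulrC; apply: ler_pM => //.
  have -> : g y / g x - 1 = (g y - g x) / g x by field; rewrite gt_eqF.
  rewrite normrM [`|_^-1|]gtr0_norm ?invr_gt0// ler_wpM2r ?invr_ge0 ?(ltW gx0)//.
  by rewrite distrC ltW.
rewrite mulrA E2 in key.
have -> : (c + (g x)^-1 * D - e * N) * g y =
  c * g y + D + D * (g y / g x - 1) - e * N * g y by field; rewrite gt_eqF.
have : e * N * (g x / 2) <= e * N * g y.
  by rewrite ler_wpM2l ?(ltW gy2)// mulr_ge0// ltW.
rewrite /e1 in num; lra.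
Qed.

Lemma Phi_frechet tau (x d : 'rV[R]_n) t : 1 < tau -> Omega g x ->
  differentiable g x -> eps_subdiff 0 f x d -> 0 <= t ->
  frechet_subdiff (Phi f h g tau) (pt x t)
    (pt ((g x)^-1 *: (d + grad h x - Fval x *: grad g x)) (t `^ (tau - 1))).
Proof.
move=> tau1 gx dg fd t0; have fx := fd.1.
apply: frechet_subdiff_approx; first by rewrite Phi_fin.
move=> e e0; have [r r0 H] := Fval_lower gx dg fd e0.
exists r => // z; rewrite (pt_split z); set y := lsubmx z; set s := rsubmx z 0 0.
rewrite ptB dot_pt Phi_fin//= PhiE => zr.
case: ifPn => [s0|_]; last exact: leey.
have N := enorm_pt_ge (y - x) (s - t).
have [/andP[fy gy]|F] := boolP ((f y < +oo)%E && (g y != 0)); last first.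
  by rewrite /objective (negbTE F) addye// leey.
rewrite objectiveE// lee_fin.
have := H y (le_lt_trans N zr) gy fy.
have := powR_tangent tau1 s0 t0.
have : e * enorm (y - x) <= e * enorm (pt (y - x) (s - t)) by rewrite ler_pM2l.
lra.
Qed.

End potential.

(** * Powers and real sequences *)

(** Tangent-line inequality for the convex function [t ^ (- a)]. *)
Lemma powRN_tangent (R : realType) (a s t : R) : 0 < a -> 0 < s -> 0 < t ->
  t `^ (- a) - a * t `^ (- (a + 1)) * (s - t) <= s `^ (- a).
Proof.
move=> a0 s0 t0; pose u := s / t; have u0 : 0 < u by rewrite divr_gt0.
have -> : s = u * t by rewrite /u divfK// gt_eqF.
have lnu : ln u <= u - 1.
  by have := expR_ge1Dx (ln u); rewrite lnK// lerBrDl.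
have ua : 1 - a * (u - 1) <= u `^ (- a).
  rewrite /powR gt_eqF//; apply: le_trans (expR_ge1Dx _).
  by rewrite mulNr lerB// ler_pM2l.
rewrite powRM ?(ltW u0) ?(ltW t0)//.
have -> : t `^ (- (a + 1)) = t `^ (- a) / t.
  by rewrite opprD powRD ?(gt_eqF t0) ?implybT// powR_inv1// ltW.
have -> : t `^ (- a) - a * (t `^ (- a) / t) * (u * t - t) =
  (1 - a * (u - 1)) * t `^ (- a) by field; rewrite gt_eqF.
by rewrite ler_wpM2r ?powR_ge0.
Qed.

(** Weighted arithmetic-geometric mean inequality. *)
Lemma powR_AGM (R : realType) (a x y : R) : 0 < a < 1 -> 0 <= x -> 0 <= y ->
  x `^ a * y `^ (1 - a) <= a * x + (1 - a) * y.
Proof.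
move=> /andP[a0 a1] x0 y0; have b0 : 0 < 1 - a by rewrite subr_gt0.
have := @conjugate_powR R (x `^ a) (y `^ (1 - a)) a^-1 (1 - a)^-1
  (powR_ge0 _ _) (powR_ge0 _ _).
rewrite !invrK !invr_gt0 -!powRrM !divff ?gt_eqF// !powRr1//.
by move=> /(_ a0 b0); rewrite subrKC [x * a]mulrC [y * _]mulrC; exact.
Qed.

Lemma natr_powRN_half (R : realType) (k : nat) (a : R) : 0 <= a ->
  k.+1%:R `^ (- a) <= 2 `^ a * k.+2%:R `^ (- a).
Proof.
move=> a0; rewrite !powRN -ler_pdivrMr ?invr_gt0 ?powR_gt0// invrK.
rewrite mulrC ler_pdivrMr ?powR_gt0// -powRM//.
rewrite ge0_ler_powR ?nnegrE ?mulr_ge0// -natrM ler_nat.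
by rewrite mul2n -addnn addnS ltnS leq_addr.
Qed.

Lemma natr_powRN_le (R : realType) (k : nat) (a b : R) : b <= a ->
  k.+1%:R `^ (- a) <= k.+1%:R `^ (- b) :> R.
Proof. by move=> ab; rewrite ler_powR ?ler1n ?lerN2. Qed.

(** Telescoping majorant of the terms [(k + 1) ^ (- a)]. *)
Lemma natr_powRN_telescope (R : realType) (k : nat) (a : R) : 1 < a ->
  k.+2%:R `^ (- (a - 1)) + (a - 1) / 2 `^ a * k.+1%:R `^ (- a) <=
  k.+1%:R `^ (- (a - 1)) :> R.
Proof.
move=> a1; have b0 : 0 < a - 1 by rewrite subr_gt0.
have := @powRN_tangent R (a - 1) k.+1%:R k.+2%:R b0 (ltr0Sn _ _) (ltr0Sn _ _).
have -> : k.+1%:R - k.+2%:R = - 1 :> R by rewrite -[in X in _ - X]natr1; ring.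
rewrite subrK mulrN1 opprK; apply: le_trans; rewrite lerD2l -mulrA.
rewrite ler_pM2l// mulrC ler_pdivrMr ?powR_gt0// mulrC natr_powRN_half//.
by rewrite ltW// (lt_trans ltr01).
Qed.

Lemma powR_expn (R : realType) (z a : R) k : 0 <= z -> (z ^+ k) `^ a = (z `^ a) ^+ k.
Proof.
by move=> z0; rewrite -powR_mulrn// -powRrM mulrC powRrM powR_mulrn// powR_ge0.
Qed.

Lemma cvg0_powR (R : realType) (u : nat -> R) (p : R) : 0 < p ->
  (forall k, 0 <= u k) -> u k @[k --> \oo] --> 0 ->
  u k `^ p @[k --> \oo] --> (0 : R).
Proof.
move=> p0 u0 uc; apply/cvgr0Pnorm_le => e e0.
have d0 : 0 < e `^ p^-1 by rewrite powR_gt0.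
have /cvgr0Pnorm_le/(_ _ d0) := uc; apply: filterS => k.
rewrite !ger0_norm ?powR_ge0// => h.
have -> : e = (e `^ p^-1) `^ p by rewrite -powRrM mulVf ?gt_eqF// powRr1// ltW.
by rewrite ge0_ler_powR ?nnegrE ?powR_ge0// ltW.
Qed.

Lemma cvg0_majorant (R : realType) (u v : nat -> R) : (forall k, 0 <= u k <= v k) ->
  v k @[k --> \oo] --> 0 -> u k @[k --> \oo] --> 0.
Proof.
move=> uv vc; apply: (@squeeze_cvgr _ _ _ _ (fun=> 0) v) => //; last exact: cvg_cst.
exact: nearW.
Qed.

Lemma cvg0_sqr (R : realType) (u v : nat -> R) (c : R) : 0 < c ->
  (forall k, 0 <= u k) -> (forall k, 0 <= v k) ->
  (forall k, c * u k ^+ 2 <= v k) ->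
  v k @[k --> \oo] --> 0 -> u k @[k --> \oo] --> 0.
Proof.
move=> c0 u0 v0 uv vc.
have vc' : (v k / c) `^ 2^-1 @[k --> \oo] --> (0 : R).
  apply: cvg0_powR; [by rewrite invr_gt0|by move=> k; rewrite divr_ge0// ltW|].
  by rewrite -[X in _ --> X](mul0r c^-1); exact: (cvgM vc (cvg_cst _)).
apply: (cvg0_majorant _ vc') => k; rewrite u0 powR12_sqrt ?divr_ge0// ?(ltW c0)//=.
rewrite -[leLHS]ger0_norm// -sqrtr_sqr ler_wsqrtr// ler_pdivlMr// mulrC.
exact: uv.
Qed.

Lemma cvg0_invpow (R : realType) (a : R) : 0 < a ->
  k.+1%:R `^ (- a) @[k --> \oo] --> (0 : R).
Proof.
move=> a0.
have -> : (fun k : nat => k.+1%:R `^ (- a)) = (fun k => (k.+1%:R^-1) `^ a) :> (nat -> R).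
  by apply/funext => k; rewrite -powR_inv1// -powRrM mulN1r.
apply: cvg0_powR => //.
exact: cvg_harmonic.
Qed.

Lemma cvg_ge_id (phi : nat -> nat) : (forall j, (j <= phi j)%N) -> phi j @[j --> \oo] --> \oo.
Proof. by move=> Hphi A [N _ HN]; exists N => // j /= Nj; apply: HN; exact: leq_trans Nj _. Qed.


Lemma real_between (R : realType) (l : R) (v : \bar R) : (l%:E < v)%E ->
  exists2 a : R, l < a & (a%:E < v)%E.
Proof.
case: v => [v||//]; last by exists (l + 1); rewrite ?ltrDl ?ltry.
by rewrite lte_fin => lv; exists ((l + v) / 2); rewrite ?lte_fin; lra.
Qed.


(** * Inexact descent sequences under the KL inequality *)

(** The scalar data of an inexact descent method near a cluster point: [dist k]
    is the distance of the [k]-th iterate to that point, [s k] the length of the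
    [k]-th step, [A k] the gap in potential, [e k] the inexactness of the
    relative error bound. The KL inequality with exponent [th] is only available
    when two consecutive iterates lie in the ball of radius [rho]. It is asked for
    positive gaps only, so that [th = 0] makes sense. *)
Record kl_descent (R : realType) (dist s e A : nat -> R)
    (th sigma C rho : R) (K0 : nat) : Prop := {
  kl_sigma : 0 < sigma;
  kl_C : 0 < C;
  kl_rho : 0 < rho;
  kl_dist : forall k, 0 <= dist k;
  kl_s : forall k, 0 <= s k;
  kl_e : forall k, 0 <= e k;
  kl_A : forall k, 0 <= A k;
  kl_A0 : A k @[k --> \oo] --> 0;
  kl_desc : forall k, A k.+1 + sigma * s k ^+ 2 <= A k;
  kl_up : forall k, dist k.+1 <= dist k + s k;
  kl_down : forall k, dist k <= dist k.+1 + s k;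
  kl_cluster : forall (eta : R) N, 0 < eta -> exists2 k, (N <= k)%N & dist k < eta;
  kl_ineq : forall k, (K0 <= k)%N -> dist k <= rho -> dist k.+1 <= rho ->
    0 < A k.+1 -> A k.+1 `^ th <= C * (s k + e k)
}.

(** An inequality with exponent [th] implies one with any larger exponent, once
    the gap is below one. *)
Lemma kl_descent_weaken (R : realType) (dist s e A : nat -> R)
    (th th' sigma C rho : R) K0 : th <= th' ->
  kl_descent dist s e A th sigma C rho K0 ->
  exists K1, kl_descent dist s e A th' sigma C rho K1.
Proof.
move=> thth' H.
have /cvgr0Pnorm_le/(_ _ ltr01) [K _ HK] := kl_A0 H.
exists (maxn K0 K); case: H => *; split=> // k; rewrite geq_max => /andP[k0 kK] d1 d2 Ap.
apply: le_trans (_ : A k.+1 `^ th <= _); last by auto.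
apply: ger_powR => //; rewrite Ap /=.
by apply: le_trans (ler_norm _) _; apply: HK => /=; exact: leqW.
Qed.

Lemma kl_gap_le (R : realType) (dist s e A : nat -> R)
    (th sigma C rho : R) K0 : kl_descent dist s e A th sigma C rho K0 ->
  forall k, A k.+1 <= A k.
Proof.
move=> H k; apply: le_trans (kl_desc H k); rewrite lerDl.
by rewrite mulr_ge0 ?sqr_ge0// ltW// (kl_sigma H).
Qed.

Lemma kl_step_cvg0 (R : realType) (dist s e A : nat -> R)
    (th sigma C rho : R) K0 : kl_descent dist s e A th sigma C rho K0 ->
  s k @[k --> \oo] --> 0.
Proof.
move=> H; apply: (cvg0_sqr (kl_sigma H) (kl_s H) (kl_A H)) (kl_A0 H) => k.
by have := kl_desc H k; have := kl_A H k.+1; lra.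
Qed.

(** One step of the KL argument: concavity of [t ^ (1 - th)] turns the KL
    inequality and the descent into a telescoping bound on the step. *)
Lemma kl_one_step (R : realType) (A1 A2 s1 w th sigma C : R) :
  0 < th < 1 -> 0 < sigma -> 0 < C -> 0 <= A2 -> 0 <= s1 -> 0 <= w -> 0 <= A1 ->
  A2 + sigma * s1 ^+ 2 <= A1 ->
  (0 < A1 -> A1 `^ th <= C * w) ->
  2 * s1 <= w + C / (sigma * (1 - th)) * (A1 `^ (1 - th) - A2 `^ (1 - th)).
Proof.
move=> /andP[th0 th1] sg0 C0 A20 s0 w0 A10 desc KL.
have a0 : 0 < 1 - th by rewrite subr_gt0.
have c0 : 0 < C / (sigma * (1 - th)) by rewrite divr_gt0// mulr_gt0.
have ss0 : 0 <= sigma * s1 ^+ 2 by rewrite mulr_ge0 ?sqr_ge0// ltW.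
have A12 : A2 <= A1 by lra.
set D := A1 `^ (1 - th) - A2 `^ (1 - th).
have D0 : 0 <= D by rewrite subr_ge0 ge0_ler_powR ?nnegrE// ltW.
have [A1p|] := ltP 0 A1; last first.
  move=> A1n; have {}A1n : A1 = 0 by apply/eqP; rewrite eq_le A1n.
  have : sigma * s1 ^+ 2 <= 0 by lra.
  rewrite pmulr_rle0// => s1n.
  have /eqP : s1 ^+ 2 = 0 by apply/eqP; rewrite eq_le s1n sqr_ge0.
  rewrite sqrf_eq0 => /eqP ->; rewrite mulr0 addr_ge0// mulr_ge0//.
  exact: ltW.
have P0 : 0 < A1 `^ th by rewrite powR_gt0.
have PD : (1 - th) * (A1 - A2) <= A1 `^ th * D.
  have := @powR_AGM R (1 - th) A2 A1; rewrite a0 gtrBl th0 => /(_ isT A20 A10); rewrite subKr.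
  have E : A1 `^ th * A1 `^ (1 - th) = A1.
    by rewrite -powRD ?subrKC ?powRr1// (gt_eqF A1p) implybT.
  rewrite /D [A1 `^ th * _]mulrBr E; lra.
have wD : (1 - th) * (sigma * s1 ^+ 2) <= C * w * D.
  apply: le_trans (_ : A1 `^ th * D <= _); last by rewrite ler_wpM2r ?KL.
  by apply: le_trans PD; rewrite ler_pM2l//; lra.
set v := C / (sigma * (1 - th)) * D.
have sv : s1 ^+ 2 <= w * v.
  have -> : w * v = (C * w * D) / (sigma * (1 - th)).
    by rewrite /v; field; rewrite !gt_eqF.
  by rewrite ler_pdivlMr ?mulr_gt0//; lra.
have v0 : 0 <= v by rewrite mulr_ge0// ltW.
have wv0 : 0 <= w + v by exact: addr_ge0.
have s20 : 0 <= 2 * s1 by exact: mulr_ge0.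
rewrite -(@ler_pXn2r _ 2)//.
have := sqr_ge0 (w - v); rewrite exprMn; lra.
Qed.

Section engine.
Variables (R : realType) (dist s e A E : nat -> R) (th sigma C rho : R) (K0 : nat).
Hypothesis H : kl_descent dist s e A th sigma C rho K0.
Hypothesis hth : 0 < th < 1.
Hypothesis E_ge0 : forall k, 0 <= E k.
Hypothesis E_dec : forall k, E k.+1 + e k <= E k.
Hypothesis E_cvg0 : E k @[k --> \oo] --> 0.

(** The majorant of the remaining length of the trajectory after step [k]. *)
Let W k := s k + E k + C / (sigma * (1 - th)) * A k.+1 `^ (1 - th).

Let cst_ge0 : 0 <= C / (sigma * (1 - th)).
Proof.
have := kl_sigma H; have := kl_C H => C0 s0.
by rewrite divr_ge0 ?mulr_ge0 ?ltW// subr_gt0; case/andP: hth.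
Qed.

Let W_ge0 k : 0 <= W k.
Proof. by rewrite !addr_ge0 ?(kl_s H)// mulr_ge0// powR_ge0. Qed.

Let W_dec k : (K0 <= k)%N -> dist k <= rho -> dist k.+1 <= rho ->
  s k.+1 <= W k - W k.+1.
Proof.
move=> kK d1 d2.
have := @kl_one_step R (A k.+1) (A k.+2) (s k.+1) (s k + e k) th sigma C hth
  (kl_sigma H) (kl_C H) (kl_A H _) (kl_s H _) (addr_ge0 (kl_s H _) (kl_e H _))
  (kl_A H _) (kl_desc H _) (kl_ineq H kK d1 d2).
have := E_dec k; rewrite /W mulrBr; lra.
Qed.

Let W_cvg0 : W k @[k --> \oo] --> 0.
Proof.
have AS : A k.+1 @[k --> \oo] --> 0 by rewrite (cvg_shiftS A); exact: (kl_A0 H).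
rewrite -[X in _ --> X](addr0 0) -{1}(addr0 0) -[X in _ --> _ + X](mulr0 (C / (sigma * (1 - th)))).
apply: cvgD; first by apply: cvgD => //; exact: (kl_step_cvg0 H).
apply: cvgM; first exact: cvg_cst.
apply: cvg0_powR AS; first by rewrite subr_gt0; case/andP: hth.
by move=> k; exact: (kl_A H).
Qed.

(** Starting close enough to the cluster point, the iterates never leave the
    ball, so that the KL inequality applies at every later step and the distance
    to the cluster point is bounded by the remaining length. *)
Lemma kl_engine : exists K1, [/\ (K0 <= K1)%N,
  forall k, (K1 <= k)%N -> dist k <= rho &
  forall k, (K1 <= k)%N ->
    dist k.+1 <= s k + E k + C / (sigma * (1 - th)) * A k.+1 `^ (1 - th)].
Proof.
have r4 : 0 < rho / 4 by rewrite divr_gt0 ?(kl_rho H).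
have rho0 := kl_rho H.
have /cvgr0Pnorm_lt/(_ _ r4) [N1 _ HN1] := kl_step_cvg0 H.
have /cvgr0Pnorm_lt/(_ _ r4) [N2 _ HN2] := W_cvg0.
have [K] := kl_cluster H (maxn K0 (maxn N1 N2)) r4.
rewrite !geq_max => /and3P[K0K N1K N2K] dK.
have sK : s K < rho / 4 by apply: le_lt_trans (ler_norm _) _; exact: HN1.
have WK : W K < rho / 4 by apply: le_lt_trans (ler_norm _) _; exact: HN2.
have dSK := kl_up H K.
have stay j : dist (K + j)%N <= rho /\ dist (K + j).+1 + W (K + j)%N <= dist K.+1 + W K.
  elim: j => [|j [d1 d2]]; first by rewrite addn0; split=> //; lra.
  have d3 : dist (K + j).+1 <= rho by have := W_ge0 (K + j); lra.
  rewrite addnS; split=> //.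
  have := W_dec (leq_trans K0K (leq_addr j K)) d1 d3.
  by have := kl_up H (K + j).+1; lra.
have inball k : (K <= k)%N -> dist k <= rho.
  by move=> Kk; have := (stay (k - K)%N).1; rewrite subnKC.
exists K; split=> // k Kk.
have tele j : dist k.+1 + W (k + j)%N <= dist (k + j).+1 + W k.
  elim: j => [|j IH]; first by rewrite addn0.
  rewrite addnS; have Kkj : (K <= k + j)%N by rewrite (leq_trans Kk)// leq_addr.
  have := W_dec (leq_trans K0K Kkj) (inball _ Kkj) (inball _ (leqW Kkj)).
  by have := kl_down H (k + j).+1; lra.
apply/ler_addgt0Pr => eta eta0.
have [m km dm] := kl_cluster H k.+1 eta0.
have := tele (m.-1 - k)%N; rewrite subnKC; last by rewrite -ltnS (ltn_predK km).
by rewrite (ltn_predK km) -/(W k); have := W_ge0 m.-1; lra.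
Qed.

Lemma kl_cvg : dist k @[k --> \oo] --> 0.
Proof.
have [K1 [_ _ HK]] := kl_engine.
apply/cvgr0Pnorm_le => eta eta0.
have /cvgr0Pnorm_le/(_ _ eta0) [N _ HN] := W_cvg0.
exists (maxn K1 N).+1 => // -[//|k] /=; rewrite ltnS geq_max => /andP[k1 kN].
rewrite ger0_norm ?(kl_dist H)//; apply: le_trans (HK _ k1) _.
by apply: le_trans (ler_norm _) _; exact: HN.
Qed.

End engine.

(** With exponent zero the gap cannot be small and positive, so it vanishes
    eventually and the method stops moving. *)
Lemma kl_finite (R : realType) (dist s e A : nat -> R) (sigma C rho : R) K0 :
  kl_descent dist s e A 0 sigma C rho K0 ->
  dist k @[k --> \oo] --> 0 -> e k @[k --> \oo] --> 0 ->
  \forall k \near \oo, dist k = 0.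
Proof.
move=> H dc ec; have sc := kl_step_cvg0 H.
have C0 := kl_C H.
have /cvgr0Pnorm_le/(_ _ (kl_rho H)) [N1 _ HN1] := dc.
have c2 : 0 < C^-1 / 2 by rewrite divr_gt0 ?invr_gt0.
have /cvgr0Pnorm_lt/(_ _ c2) [N2 _ HN2] := sc.
have /cvgr0Pnorm_lt/(_ _ c2) [N3 _ HN3] := ec.
pose N := maxn K0 (maxn N1 (maxn N2 N3)).
have AN k : (N <= k)%N -> A k.+1 = 0.
  rewrite !geq_max => /and4P[k0 k1 k2 k3]; apply/eqP; rewrite eq_le (kl_A H) andbT.
  rewrite leNgt; apply/negP => Ap.
  have d1 : dist k <= rho by apply: le_trans (ler_norm _) _; exact: HN1.
  have d2 : dist k.+1 <= rho.
    by apply: le_trans (ler_norm _) _; apply: HN1; exact: leqW.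
  have := kl_ineq H k0 d1 d2 Ap; rewrite powRr0.
  have s1 : s k < C^-1 / 2 by apply: le_lt_trans (ler_norm _) _; exact: HN2.
  have e1 : e k < C^-1 / 2 by apply: le_lt_trans (ler_norm _) _; exact: HN3.
  apply/negP; rewrite -ltNge -[ltRHS](divff (lt0r_neq0 C0)) ltr_pM2l//.
  by move: s1 e1; set i := C^-1; lra.
have s0 k : (N < k)%N -> s k = 0.
  case: k => // k; rewrite ltnS => Nk; have := kl_desc H k.+1.
  rewrite !AN// ?leqW// add0r pmulr_rle0 ?(kl_sigma H)// => h.
  by apply/eqP; rewrite -sqrf_eq0 eq_le h sqr_ge0.
exists N.+1 => // k /= Nk.
have cst j : dist (k + j)%N = dist k.
  elim: j => [|j IH]; first by rewrite addn0.
  have := kl_up H (k + j); have := kl_down H (k + j).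
  rewrite addnS s0 ?(leq_trans Nk) ?leq_addr// !addr0 IH => h1 h2.
  by apply/eqP; rewrite eq_le h1 h2.
apply/eqP; rewrite eq_le (kl_dist H) andbT; apply/ler_addgt0Pr => eta eta0.
have [m km dm] := kl_cluster H k eta0.
by have := cst (m - k)%N; rewrite subnKC// => <-; rewrite add0r ltW.
Qed.

(** * Convergence rates *)

(** Eliminating the step length between the descent and the KL inequality leaves
    a recursion for the gap alone. *)
Lemma kl_gap_recursion (R : realType) (dist s e A : nat -> R)
    (th sigma C rho : R) K0 : 0 < th ->
  kl_descent dist s e A th sigma C rho K0 ->
  forall k, (K0 <= k)%N -> dist k <= rho -> dist k.+1 <= rho ->
  A k.+1 + sigma / (2 * C ^+ 2) * (A k.+1 `^ th) ^+ 2 <= A k + sigma * e k ^+ 2.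
Proof.
move=> th0 H k kK d1 d2.
have C0 := kl_C H; have sg0 := kl_sigma H; have s0 := kl_s H k; have e0 := kl_e H k.
have KL : A k.+1 `^ th <= C * (s k + e k).
  have [Ap|An] := ltP 0 (A k.+1); first exact: (kl_ineq H).
  have -> : A k.+1 = 0 by apply/eqP; rewrite eq_le An (kl_A H).
  by rewrite powR0 ?gt_eqF// mulr_ge0 ?addr_ge0// ltW.
have : (A k.+1 `^ th) ^+ 2 <= 2 * C ^+ 2 * (s k ^+ 2 + e k ^+ 2).
  apply: (@le_trans _ _ ((C * (s k + e k)) ^+ 2)).
    by rewrite ler_pXn2r// nnegrE ?powR_ge0// mulr_ge0 ?addr_ge0// ltW.
  rewrite exprMn -[leRHS]mulrA [leRHS]mulrCA ler_wpM2l ?sqr_ge0//.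
  by have := sqr_ge0 (s k - e k); lra.
have c0 : 0 < 2 * C ^+ 2 by rewrite mulr_gt0// exprn_gt0.
rewrite -ler_pdivrMl// => h.
have := kl_desc H k.
have : sigma * ((2 * C ^+ 2)^-1 * (A k.+1 `^ th) ^+ 2) <= sigma * (s k ^+ 2 + e k ^+ 2).
  by rewrite ler_pM2l.
rewrite mulrA; lra.
Qed.

Lemma powR_sqr (R : realType) (u th : R) : (u `^ th) ^+ 2 = u `^ (2 * th).
Proof. by rewrite -powR_mulrn ?powR_ge0// -powRrM mulrC. Qed.

(** The recursion with exponent [2 th = 2 p / (2 p - 1)] forces the decay
    [k ^ (- (2 p - 1))]. *)
Lemma gap_poly_rate (R : realType) (A : nat -> R) (al be p : R) K :
  0 < al -> 0 <= be -> 1 < p -> (forall k, 0 <= A k) ->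
  (forall k, (K <= k)%N -> A k.+1 + al * (A k.+1 `^ (p / (2 * p - 1))) ^+ 2 <=
      A k + be * k.+1%:R `^ (- (2 * p))) ->
  exists2 B : R, 0 < B & forall k, (K <= k)%N -> A k <= B * k.+1%:R `^ (- (2 * p - 1)).
Proof.
move=> al0 be0 p1 A0 rec; set a := 2 * p - 1; have a0 : 0 < a by rewrite /a; lra.
have ap : a + 1 = 2 * p by rewrite /a subrK.
pose c := 2 `^ (2 * p) : R; have c0 : 0 < c by rewrite powR_gt0.
(* [b0] is what [B ^ (1 / a)] has to dominate in the induction step; the last
   summand of [B] starts the induction. *)
pose b0 := (a + be) * c / al.
have b00 : 0 <= b0 by rewrite divr_ge0 ?(ltW al0)// mulr_ge0 ?(ltW c0)//; lra.
pose B := 1 + b0 `^ a + A K / K.+1%:R `^ (- a).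
have AK0 : 0 <= A K / K.+1%:R `^ (- a) by rewrite divr_ge0 ?powR_ge0.
have b0a : 0 <= b0 `^ a by exact: powR_ge0.
have B1 : 1 <= B by rewrite /B; lra.
have Bp : 0 < B by lra.
exists B => // k /subnKC <-; elim: (k - K)%N => [|j IH] {k}.
  rewrite addn0 -ler_pdivrMr ?powR_gt0// /B; lra.
rewrite addnS; set k := (K + j)%N in IH *.
have {}rec := rec k (leq_addr _ _).
(* If the bound failed at [k + 1], the recursion would make [A k] too large. *)
rewrite leNgt; apply/negP => lt.
set Y := k.+2%:R `^ (- a) in lt; set X := k.+1%:R `^ (- a) in IH.
set Z' := k.+1%:R `^ (- (2 * p)) in rec; set Z := k.+2%:R `^ (- (2 * p)) : R.
have Z0 : 0 < Z by exact: powR_gt0.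
have tan : X - a * Z' <= Y.
  have := @powRN_tangent R a k.+2%:R k.+1%:R a0 (ltr0Sn _ _) (ltr0Sn _ _).
  by rewrite -natrB// subSnn mulr1 ap.
have ZZ : Z' <= c * Z by apply: natr_powRN_half; lra.
set b := B `^ a^-1; have bge : b0 <= b.
  have -> : b0 = (b0 `^ a) `^ a^-1 by rewrite -powRrM divff ?gt_eqF// powRr1.
  by rewrite ge0_ler_powR ?nnegrE ?invr_ge0 ?(ltW a0) ?(ltW Bp)// /B; lra.
have pw : B * b * Z <= (A k.+1 `^ (p / a)) ^+ 2.
  have -> : B * b * Z = ((B * Y) `^ (p / a)) ^+ 2.
    rewrite powR_sqr powRM ?(ltW Bp) ?powR_ge0// /Y -powRrM.
    have -> : - a * (2 * (p / a)) = - (2 * p) by field; rewrite gt_eqF.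
    congr (_ * _); rewrite /b -{1}(powRr1 (ltW Bp)) -powRD ?(gt_eqF Bp) ?implybT//.
    by congr (_ `^ _); rewrite mulrA -ap; field; rewrite gt_eqF.
  rewrite ler_pXn2r ?nnegrE ?powR_ge0// ge0_ler_powR ?nnegrE ?(ltW lt)//.
    by rewrite divr_ge0 ?(ltW a0)//; lra.
  by rewrite mulr_ge0 ?powR_ge0// ltW.
have h1 : al * (B * b * Z) <= al * (A k.+1 `^ (p / a)) ^+ 2 by rewrite ler_pM2l.
have h2 : B * (X - a * Z') <= B * Y by rewrite ler_pM2l.
have h3 : (B * a + be) * Z' <= (B * a + be) * (c * Z).
  by rewrite ler_wpM2l// addr_ge0// mulr_ge0// ltW.
have h4 : (B * a + be) * (c * Z) <= B * (a + be) * (c * Z).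
  rewrite ler_wpM2r//; first by rewrite mulr_ge0// ltW.
  by have := ler_peMl be0 B1; lra.
have h5 : B * (a + be) * (c * Z) <= al * (B * b * Z).
  have -> : B * (a + be) * (c * Z) = B * al * Z * b0 by rewrite /b0; field; rewrite gt_eqF.
  have -> : al * (B * b * Z) = B * al * Z * b by ring.
  by rewrite ler_wpM2l// ltW// !mulr_gt0.
lra.
Qed.

Lemma eventually_O_shift (R : realType) (u v : nat -> R) (B : R) K : 0 < B ->
  (forall k, (K <= k)%N -> u k.+1 <= B * v k.+1) -> eventually_O u v.
Proof. by move=> B0 h; exists B => //; exists K.+1 => // -[//|k] /=; exact: h. Qed.

(** When the KL exponent [p / (2 p - 1)] matches the decay [k ^ (- p)] of the
    errors, the distance decays like the tails [k ^ (- (p - 1))] of the errors. *)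
Lemma kl_poly_rate (R : realType) (dist s e A E : nat -> R)
    (p sigma C rho Ce CE : R) K0 : 1 < p ->
  kl_descent dist s e A (p / (2 * p - 1)) sigma C rho K0 ->
  (forall k, 0 <= E k) -> (forall k, E k.+1 + e k <= E k) ->
  E k @[k --> \oo] --> 0 ->
  (forall k, e k <= Ce * k.+1%:R `^ (- p)) ->
  (forall k, E k <= CE * k.+1%:R `^ (- (p - 1))) ->
  eventually_O dist (fun k => k%:R `^ (- (p - 1))).
Proof.
move=> p1 H E0 Edec Ec eb Eb.
set th := p / (2 * p - 1) in H; have a0 : 0 < 2 * p - 1 by lra.
have th0 : 0 < th by rewrite divr_gt0//; lra.
have th1 : th < 1 by rewrite ltr_pdivrMr//; lra.
have th01 : 0 < th < 1 by rewrite th0.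
have C0 := kl_C H; have sg0 := kl_sigma H.
have [K1 [K01 ball tail]] := kl_engine H th01 E0 Edec Ec.
have al0 : 0 < sigma / (2 * C ^+ 2) by rewrite divr_gt0// mulr_gt0// exprn_gt0.
have be0 : 0 <= sigma * Ce ^+ 2 by rewrite mulr_ge0 ?sqr_ge0// ltW.
have [B B0 HB] : exists2 B : R, 0 < B &
    forall k, (K1 <= k)%N -> A k <= B * k.+1%:R `^ (- (2 * p - 1)).
  apply: (gap_poly_rate al0 be0 p1 (kl_A H)) => k kK.
  have := kl_gap_recursion th0 H (leq_trans K01 kK) (ball _ kK) (ball _ (leqW kK)).
  move=> /le_trans; apply; rewrite lerD2l -mulrA ler_pM2l//.
  apply: (@le_trans _ _ ((Ce * k.+1%:R `^ (- p)) ^+ 2)); last first.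
    by rewrite exprMn powR_sqr mulrN.
  by rewrite ler_pXn2r ?nnegrE ?(kl_e H) ?(le_trans (kl_e H _) (eb _)).
set cst := C / (sigma * (1 - th)) in tail.
have cst0 : 0 <= cst by rewrite divr_ge0 ?mulr_ge0 ?ltW// subr_gt0.
pose D := Num.sqrt (B / sigma) + `|CE| + cst * B `^ (1 - th) + 1.
have D0 : 0 < D.
  by rewrite ltr_wpDl// !addr_ge0 ?sqrtr_ge0// mulr_ge0 ?powR_ge0.
apply: (@eventually_O_shift _ _ _ D K1) => // k kK.
set P := k.+1%:R `^ (- (p - 1)); have P0 : 0 <= P by exact: powR_ge0.
apply: le_trans (tail _ kK) _.
have t1 : s k <= Num.sqrt (B / sigma) * P.
  have -> : P = Num.sqrt (k.+1%:R `^ (- (2 * (p - 1)))).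
    by rewrite -powR12_sqrt ?powR_ge0// -powRrM; congr (_ `^ _); lra.
  rewrite -sqrtrM ?divr_ge0 ?(ltW B0) ?(ltW sg0)//.
  rewrite -[leLHS]ger0_norm ?(kl_s H)// -sqrtr_sqr ler_wsqrtr// mulrAC ler_pdivlMr//.
  have := kl_desc H k; have := kl_A H k.+1; have := HB k kK.
  have : B * k.+1%:R `^ (- (2 * p - 1)) <= B * k.+1%:R `^ (- (2 * (p - 1))).
    by rewrite ler_pM2l// natr_powRN_le//; lra.
  lra.
have t2 : E k <= `|CE| * P.
  by apply: le_trans (Eb k) _; rewrite ler_wpM2r// ler_norm.
have t3 : A k.+1 `^ (1 - th) <= B `^ (1 - th) * P.
  apply: (@le_trans _ _ ((B * k.+1%:R `^ (- (2 * p - 1))) `^ (1 - th))).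
    have th1' : 0 <= 1 - th by rewrite subr_ge0 ltW.
    rewrite ge0_ler_powR ?nnegrE ?(kl_A H) ?mulr_ge0 ?powR_ge0 ?(ltW B0)//.
    exact: le_trans (kl_gap_le H k) (HB _ kK).
  rewrite powRM ?powR_ge0 ?(ltW B0)// -powRrM.
  have -> : - (2 * p - 1) * (1 - th) = - (p - 1) by rewrite /th; field; rewrite gt_eqF.
  by [].
have t4 : cst * A k.+1 `^ (1 - th) <= cst * (B `^ (1 - th) * P) by rewrite ler_wpM2l.
rewrite /D; lra.
Qed.

(** With exponent [1 / 2] the gap recursion is linear, so geometric errors give a
    geometric rate. *)
Lemma kl_geometric_rate (R : realType) (dist s e A E : nat -> R)
    (z sigma C rho Ce CE : R) K0 : 0 < z < 1 ->
  kl_descent dist s e A (1 / 2) sigma C rho K0 ->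
  (forall k, 0 <= E k) -> (forall k, E k.+1 + e k <= E k) ->
  E k @[k --> \oo] --> 0 ->
  (forall k, e k <= Ce * z ^+ k) -> (forall k, E k <= CE * z ^+ k) ->
  exists2 zz : R, 0 < zz < 1 & eventually_O dist (fun k => zz ^+ k).
Proof.
move=> /andP[z0 z1] H E0 Edec Ec eb Eb.
have th01 : 0 < (1 / 2 : R) < 1 by lra.
have C0 := kl_C H; have sg0 := kl_sigma H.
have [K1 [K01 ball tail]] := kl_engine H th01 E0 Edec Ec.
set al := sigma / (2 * C ^+ 2); have al0 : 0 < al by rewrite divr_gt0// mulr_gt0// exprn_gt0.
set be := sigma * Ce ^+ 2; have be0 : 0 <= be by rewrite mulr_ge0 ?sqr_ge0// ltW.
have A0 := kl_A H.
pose b := (1 + al)^-1.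
have b0 : 0 < b by rewrite invr_gt0; lra.
have b1 : b < 1 by rewrite invf_lt1; lra.
have z20 : 0 < z ^+ 2 by rewrite exprn_gt0.
have z21 : z ^+ 2 < 1 by rewrite expr_lt1// ltW.
pose l := Num.max b (z ^+ 2).
have l1 : l < 1 by rewrite gt_max b1.
have bl : b <= l by rewrite le_max lexx.
have zl : z ^+ 2 <= l by rewrite le_max lexx orbT.
(* A rate strictly between [l] and [1] absorbs the error term. *)
pose l' := (1 + l) / 2.
have l'1 : l' < 1 by rewrite /l'; lra.
have ll' : l < l' by rewrite /l'; lra.
have l'0 : 0 < l' by lra.
pose B := 1 + be / (l' - b) + A K1 / l' ^+ K1.
have lb : 0 < l' - b by lra.
have q1 : 0 <= be / (l' - b) by rewrite divr_ge0// ltW.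
have q2 : 0 <= A K1 / l' ^+ K1 by rewrite divr_ge0// exprn_ge0// ltW.
have B0 : 0 < B by rewrite /B; lra.
have HB k : (K1 <= k)%N -> A k <= B * l' ^+ k.
  move=> /subnKC <-; elim: (k - K1)%N => [|j IH] {k}.
    rewrite addn0 -ler_pdivrMr ?exprn_gt0// /B; lra.
  rewrite addnS; set k := (K1 + j)%N in IH *.
  have kK : (K1 <= k)%N by exact: leq_addr.
  have := kl_gap_recursion (andP th01).1 H (leq_trans K01 kK) (ball _ kK) (ball _ (leqW kK)).
  rewrite div1r powR12_sqrt// sqr_sqrtr// -/al => rec.
  have ek : e k ^+ 2 <= Ce ^+ 2 * l' ^+ k.
    apply: (@le_trans _ _ ((Ce * z ^+ k) ^+ 2)).
      by rewrite ler_pXn2r ?nnegrE ?(kl_e H) ?(le_trans (kl_e H _) (eb _)).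
    rewrite exprMn ler_wpM2l ?sqr_ge0// exprAC.
    by apply: lerXn2r; rewrite ?nnegrE ?(ltW l'0) ?(ltW z20)//; lra.
  have sk : sigma * e k ^+ 2 <= be * l' ^+ k by rewrite /be -mulrA ler_pM2l.
  have : A k.+1 <= b * (B * l' ^+ k + be * l' ^+ k).
    by rewrite mulrC ler_pdivlMr; lra.
  move=> /le_trans; apply; rewrite exprS mulrA -mulrDl mulrA ler_wpM2r ?exprn_ge0 ?(ltW l'0)//.
  have : be <= (l' - b) * B.
    by rewrite mulrC -ler_pdivrMr// /B; lra.
  have : b * be <= be by rewrite ler_piMl// ltW.
  lra.
(* The distance is of the order of the square root of the gap. *)
pose zz := Num.sqrt l'.
have zz0 : 0 < zz by rewrite sqrtr_gt0.
have zz2 : zz ^+ 2 = l' by rewrite sqr_sqrtr// ltW.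
exists zz.
  by rewrite zz0 -sqrtr1 ltr_sqrt.
have zzz : z <= zz.
  by rewrite -[leLHS](ger0_norm (ltW z0)) -sqrtr_sqr ler_wsqrtr//; lra.
set cst := C / (sigma * (1 - 1 / 2)) in tail.
have cst0 : 0 <= cst by rewrite divr_ge0 ?mulr_ge0 ?ltW//; lra.
pose D := (Num.sqrt (B / sigma) + `|CE| + cst * Num.sqrt B + 1) / zz.
have D0 : 0 < D.
  by rewrite divr_gt0// ltr_wpDl// !addr_ge0 ?sqrtr_ge0// mulr_ge0 ?sqrtr_ge0.
apply: (@eventually_O_shift _ _ _ D K1) => // k kK.
rewrite exprS /D mulrA divfK ?gt_eqF//.
set P := zz ^+ k; have P0 : 0 <= P by rewrite exprn_ge0// ltW.
have PE : P = Num.sqrt (l' ^+ k).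
  by rewrite -zz2 -exprM mulnC exprM sqrtr_sqr ger0_norm.
apply: le_trans (tail _ kK) _.
have t1 : s k <= Num.sqrt (B / sigma) * P.
  rewrite PE -sqrtrM ?divr_ge0 ?(ltW B0) ?(ltW sg0)//.
  rewrite -[leLHS]ger0_norm ?(kl_s H)// -sqrtr_sqr ler_wsqrtr// mulrAC ler_pdivlMr//.
  have := kl_desc H k; have := kl_A H k.+1; have := HB k kK; lra.
have t2 : E k <= `|CE| * P.
  apply: le_trans (Eb k) _; apply: (@le_trans _ _ (`|CE| * z ^+ k)).
    by rewrite ler_wpM2r ?exprn_ge0 ?(ltW z0)// ler_norm.
  by rewrite ler_wpM2l//; apply: lerXn2r; rewrite ?nnegrE ?(ltW z0) ?(ltW zz0).
have t3 : A k.+1 `^ (1 - 1 / 2) <= Num.sqrt B * P.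
  have -> : 1 - 1 / 2 = 2^-1 :> R by field.
  rewrite powR12_sqrt// PE -sqrtrM ?(ltW B0)// ler_wsqrtr//.
  exact: le_trans (kl_gap_le H k) (HB _ kK).
have t4 : cst * A k.+1 `^ (1 - 1 / 2) <= cst * (Num.sqrt B * P) by rewrite ler_wpM2l.
lra.
Qed.

(** * Quadratic forms of the scaling matrices *)

Lemma dot_mulmx (R : realType) n (u v : 'rV[R]_n) : dot u v = (u *m v^T) 0 0.
Proof. by rewrite mxE; apply: eq_bigr => i _; rewrite mxE. Qed.

Lemma dot_sym_mx (R : realType) n (A : 'M[R]_n) (u v : 'rV[R]_n) :
  A^T = A -> dot (u *m A) v = dot (v *m A) u.
Proof. by move=> sA; rewrite (dotC (v *m A)) !dot_mulmx trmx_mul sA mulmxA. Qed.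

Lemma loewner_ge (R : realType) n (A : 'M[R]_n) c (v : 'rV[R]_n) :
  loewner_le c%:M A -> c * enorm v ^+ 2 <= dot (v *m A) v.
Proof.
by move=> /(_ v); rewrite mulmxBr (dotBl (v *m A)) mul_mx_scalar dotZl subr_ge0 enorm_sqr.
Qed.

Lemma loewner_ub (R : realType) n (A : 'M[R]_n) c (v : 'rV[R]_n) :
  loewner_le A c%:M -> dot (v *m A) v <= c * enorm v ^+ 2.
Proof.
by move=> /(_ v); rewrite mulmxBr (dotBl (v *m c%:M)) mul_mx_scalar dotZl subr_ge0 enorm_sqr.
Qed.

(** A positive semidefinite matrix bounded by [c] in the Loewner order has
    operator norm at most [c]; this is Cauchy-Schwarz for its quadratic form,
    applied to [v] and [v A]. *)
Lemma enorm_mulmx_le (R : realType) n (A : 'M[R]_n) c (v : 'rV[R]_n) :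
  A^T = A -> (forall u : 'rV[R]_n, 0 <= dot (u *m A) u) -> 0 <= c ->
  loewner_le A c%:M -> enorm (v *m A) <= c * enorm v.
Proof.
move=> sA psd c0 Ac; set w := v *m A.
have CS : dot w w ^+ 2 <= dot w v * dot (w *m A) w.
  apply: psd_CS; [exact: psd|exact: psd|] => s t.
  have := psd (s *: v + t *: w).
  rewrite mulmxDl -!scalemxAl -/w.
  rewrite (dotDl (s *: w)) !(dotDr (s *: v)) !dotZl !dotZr.
  rewrite (dot_sym_mx w v sA) -/w; congr (_ <= _); ring.
have h1 := loewner_ub v Ac; have h2 := loewner_ub w Ac.
have {}CS : (enorm w ^+ 2) ^+ 2 <= (c * enorm v ^+ 2) * (c * enorm w ^+ 2).
  rewrite enorm_sqr; apply: le_trans CS _.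
  by apply: ler_pM; rewrite ?psd// -enorm_sqr.
have [w0|w0] := eqVneq (enorm w) 0; first by rewrite w0 mulr_ge0 ?enorm_ge0.
have wp : 0 < enorm w ^+ 2 by rewrite exprn_gt0// lt_def w0 enorm_ge0.
have {}CS : enorm w ^+ 2 <= (c * enorm v) ^+ 2.
  by rewrite -(ler_pM2r wp) -expr2 (le_trans CS)// exprMn; lra.
by rewrite -(@ler_pXn2r _ 2)// ?nnegrE ?mulr_ge0 ?enorm_ge0.
Qed.

(** * The run of the algorithm *)

Section run.
Variables (R : realType) (n : nat).
Variables (f : 'rV[R]_n -> \bar R) (h g : 'rV[R]_n -> R) (Lh : R).
Variables (eps : nat -> R) (H : nat -> 'M[R]_n).
Variables (x y Delta : nat -> 'rV[R]_n) (delta : nat -> R) (gam_lo gam_hi : R).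
(* [dh] and [dg] are the gradients of [h] and [g], which enter through the
   properties below only. *)
Variables (dh dg : 'rV[R]_n -> 'rV[R]_n).
Hypothesis hA : standing_assumptions f h g Lh.
Hypothesis hx : iVPGSA f h g eps H x y Delta delta.
Hypothesis hgam0 : 0 < gam_lo.
Hypothesis hgam_Lh : Lh / 2 < gam_lo.
Hypothesis hgam_le : gam_lo <= gam_hi.
Hypothesis hH : forall k, loewner_le gam_lo%:M (H k) /\ loewner_le (H k) gam_hi%:M.
Hypothesis h_up : forall u v,
  h v - h u <= dot (dh u) (v - u) + Lh / 2 * enorm (v - u) ^+ 2.
Hypothesis dh_lip : forall u v, enorm (dh u - dh v) <= Lh * enorm (u - v).
Hypothesis dgP : forall k, y k = dg (x k).
Hypothesis step : forall k, exists2 d, eps_subdiff (delta k) f (x k.+1) d &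
  Delta k = d + dh (x k) - Fval f h g (x k) *: y k + (x k.+1 - x k) *m H k.

Local Notation c := (fun k => Fval f h g (x k)).
Local Notation s := (fun k => x k.+1 - x k).

Lemma run_Omega k : Omega g (x k). Proof. by case: (x_feasible hx k). Qed.
Lemma run_dom k : edom f (x k). Proof. by case: (x_feasible hx k). Qed.

Lemma run_g_gt0 k : 0 < g (x k).
Proof. exact: (g_gt0 hA (run_Omega k) (run_dom k)). Qed.

Lemma run_Fval_ge0 k : 0 <= c k.
Proof. exact: (Fval_ge0 hA (run_Omega k) (run_dom k)). Qed.

Lemma run_FvalE k : fine (f (x k)) + h (x k) = c k * g (x k).
Proof. by rewrite /Fval divfK// gt_eqF ?run_g_gt0. Qed.

Lemma run_g_subgradient k v : g (x k) + dot (y k) (v - x k) <= g v.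
Proof. by have [_ /(_ v)] := y_subgradient hx k; rewrite sube0 -EFinD lee_fin. Qed.

(** Sufficient decrease of the quotient, up to the error [eps k]. *)
Lemma run_descent k :
  c k.+1 + (gam_lo - Lh / 2) * enorm (s k) ^+ 2 / g (x k.+1) <= c k + eps k.
Proof.
have [d [_ /(_ (x k)) dsub] De] := step k.
have gp := run_g_gt0 k.+1.
have hu := h_up (x k) (x k.+1).
have gs := run_g_subgradient k (x k.+1).
have err := x_error hx k.
have Hl := loewner_ge (s k) (hH k).1.
have c0 := run_Fval_ge0 k.
have E0 := run_FvalE k; have E1 := run_FvalE k.+1.
move: dsub; rewrite (f_fin hA (run_dom k.+1)) (f_fin hA (run_dom k)).
rewrite -EFinD lee_fin -(opprB (x k.+1) (x k)).
move: De hu gs err Hl; move: (c k) (c k.+1) c0 E0 E1 => ck ck1 c0 E0 E1.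
move: (x k.+1 - x k) => sk De hu gs err Hl.
rewrite (dotNr sk d).
have dE : dot (Delta k) sk =
    dot d sk + dot (dh (x k)) sk - ck * dot (y k) sk + dot (sk *m H k) sk.
  by rewrite De dotDl (dotBl (d + dh (x k))) dotDl dotZl.
have e2 := sqr_ge0 (enorm (Delta k)).
have nd := ler_norm (dot (Delta k) sk).
have cg : ck * (g (x k) + dot (y k) sk) <= ck * g (x k.+1) by rewrite ler_wpM2l.
move=> ds; rewrite -(ler_pM2r gp) [leLHS]mulrDl divfK ?gt_eqF//.
lra.
Qed.

Section majorant.
(* [r] majorizes the tails of the error series, and plays the part of
   [t ^ tau / tau] in the potential. *)
Variable r : nat -> R.
Hypothesis r_ge0 : forall k, 0 <= r k.
Hypothesis r_dec : forall k, r k.+1 + eps k <= r k.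
Hypothesis r_cvg0 : r k @[k --> \oo] --> 0.

Lemma run_potential_le k : c k + r k <= c 0%N + r 0%N.
Proof.
elim: k => // k; apply: le_trans.
have := run_descent k; have := r_dec k.
have : 0 <= (gam_lo - Lh / 2) * enorm (s k) ^+ 2 / g (x k.+1).
  by rewrite divr_ge0 ?(ltW (run_g_gt0 _))// mulr_ge0 ?sqr_ge0// subr_ge0 ltW.
lra.
Qed.

Lemma run_Fval_le k : c k <= c 0%N + r 0%N.
Proof. by apply: le_trans (run_potential_le k); rewrite lerDl. Qed.

Lemma run_bounded : exists2 B : R, 0 < B & forall k, `|x k| <= B.
Proof.
have [B [_ HB]] := objective_level_bounded hA (c 0%N + r 0%N).
exists (`|B| + 1); first by rewrite ltr_wpDl.
move=> k; apply: (HB (`|B| + 1)) => /=.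
  by rewrite (le_lt_trans (ler_norm B))// ltrDl.
by rewrite (objectiveE hA (run_Omega k) (run_dom k)) lee_fin; exact: run_Fval_le.
Qed.

Lemma run_g_bounded : exists2 M : R, 0 < M & forall k, g (x k) <= M.
Proof.
have [B B0 HB] := run_bounded.
have [||z _ Hz] := @EVT_max_rV R n g _ _ (@norm_ball_compact R n B).
- by exists 0; rewrite /= normr0 ltW.
- exact: continuous_subspaceT (g_continuous hA).
have gx k : g (x k) <= g z by apply: Hz; rewrite inE /=.
by exists (g z) => //; apply: lt_le_trans (run_g_gt0 0) (gx 0%N).
Qed.

(** The iterates stay in a sublevel set of the objective, which is bounded. *)
Lemma run_cluster : exists xs : 'rV[R]_n, forall (eta : R) N, 0 < eta ->
  exists2 k, (N <= k)%N & enorm (x k - xs) < eta.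
Proof.
have [B B0 HB] := run_bounded.
have [|xs [_ cl]] := @norm_ball_compact R n B (x @ \oo) _.
  by exists 0%N => // k _; exact: HB.
exists xs => eta N eta0.
have [||z [[k Nk <-] kz]] := cl (x @` [set k | (N <= k)%N])
    [set z | enorm (z - xs) < eta].
- by exists N => // k /= Nk; exists k.
- by apply/nbhs_enormP; exists eta.
- by exists k.
Qed.

Lemma run_potential_descent : exists2 sigma : R, 0 < sigma &
  forall k, c k.+1 + r k.+1 + sigma * enorm (s k) ^+ 2 <= c k + r k.
Proof.
have [M M0 HM] := run_g_bounded.
have g0 : 0 < gam_lo - Lh / 2 by rewrite subr_gt0.
exists ((gam_lo - Lh / 2) / M); first exact: divr_gt0.
move=> k; have := run_descent k; have := r_dec k.
have : (gam_lo - Lh / 2) / M * enorm (s k) ^+ 2 <=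
    (gam_lo - Lh / 2) * enorm (s k) ^+ 2 / g (x k.+1).
  rewrite mulrAC; apply: ler_wpM2l; first by rewrite mulr_ge0 ?sqr_ge0 ?(ltW g0).
  by rewrite lef_pV2 ?posrE ?run_g_gt0.
lra.
Qed.

Lemma run_potential_cvg : exists l : R, c k + r k @[k --> \oo] --> l.
Proof.
have [sigma s0 Hs] := run_potential_descent.
apply/cvg_ex; apply: nonincreasing_is_cvgn.
  apply/nonincreasing_seqP => k; apply: le_trans (Hs k).
  by rewrite lerDl mulr_ge0 ?sqr_ge0// ltW.
by exists 0 => _ [k _ <-]; rewrite addr_ge0// run_Fval_ge0.
Qed.

Section cluster_point.
Variable xs : 'rV[R]_n.
Hypothesis cl : forall (eta : R) N, 0 < eta ->
  exists2 k, (N <= k)%N & enorm (x k - xs) < eta.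
Hypothesis hf_lip : forall x0 : 'rV[R]_n, edom f x0 ->
  exists2 O : set 'rV[R]_n, nbhs x0 O &
  exists2 L : R, 0 < L &
    forall u v, O u -> edom f u -> O v -> edom f v ->
      `|fine (f u) - fine (f v)| <= L * enorm (u - v).

(** A subsequence converging to the cluster point, along which any property that
    holds for all late iterates near that point can be required. *)
Lemma run_subsequence (P : nat -> Prop) :
  (exists2 eta : R, 0 < eta & exists N, forall k, (N <= k)%N ->
     enorm (x k - xs) < eta -> P k) ->
  exists2 phi : nat -> nat, forall j, (j <= phi j)%N /\ P (phi j) &
    x (phi j) @[j --> \oo] --> xs.
Proof.
move=> [eta eta0 [N HN]].
have /choice [phi Hphi] : forall j, exists k,
    [/\ (j <= k)%N, (N <= k)%N, enorm (x k - xs) < eta & enorm (x k - xs) < j.+1%:R^-1].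
  move=> j; have m0 : 0 < Num.min eta j.+1%:R^-1 by rewrite lt_min eta0 invr_gt0 ltr0Sn.
  have [k kN] := cl (maxn j N) m0.
  rewrite lt_min => /andP[k1 k2].
  move: kN; rewrite geq_max => /andP[k3 k4].
  by exists k.
exists phi => [j|]; first by have [? ? ? _] := Hphi j; split=> //; exact: HN.
apply: cvg_enorm => e e0.
have /cvgr0Pnorm_lt/(_ _ e0) := @cvg_harmonic R; apply: filterS => j.
rewrite ger0_norm ?invr_ge0// => je; have [_ _ _ lt] := Hphi j.
exact: lt_trans lt je.
Qed.

(** A cluster point is feasible: closedness of [f] bounds [f + h] there by the
    limit value times [g], so [g] cannot vanish. The potential then converges to
    the objective value at the cluster point. *)
Lemma run_cluster_point : [/\ edom f xs, Omega g xs &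
  c k + r k @[k --> \oo] --> Fval f h g xs].
Proof.
have [l cl_l] := run_potential_cvg.
have c_l : c k @[k --> \oo] --> l.
  rewrite -[l]subr0; have -> : c = (fun k => (c k + r k) - r k).
    by apply/funext => k; rewrite addrK.
  exact: cvgB.
have [phi Hphi xphi] : exists2 phi : nat -> nat, forall j, (j <= phi j)%N /\ True &
    x (phi j) @[j --> \oo] --> xs.
  by apply: (run_subsequence (P := fun=> True)); exists 1 => //; exists 0%N.
have phioo : phi j @[j --> \oo] --> \oo by apply: cvg_ge_id => j; have [] := Hphi j.
have cphi : c (phi j) @[j --> \oo] --> l := cvg_comp phi c phioo c_l.
have gphi : g (x (phi j)) @[j --> \oo] --> g xs.
  exact: (cvg_comp _ g xphi (g_continuous hA (x:=xs))).
have hphi : h (x (phi j)) @[j --> \oo] --> h xs.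
  exact: (cvg_comp _ h xphi (differentiable_continuous (h_differentiable hA xs))).
pose u j := c (phi j) * g (x (phi j)) - h (x (phi j)).
have uE j : fine (f (x (phi j))) = u j by rewrite /u -run_FvalE addrK.
have u_l : u j @[j --> \oo] --> l * g xs - h xs by apply: cvgB => //; exact: cvgM.
(* Lower semicontinuity: a value of [f] above the limit would stay above it along
   the subsequence. *)
have fle : (f xs <= (l * g xs - h xs)%:E)%E.
  rewrite leNgt; apply/negP => /real_between [a la af].
  have [V Vxs HV] := f_closed hA af.
  have : \forall j \near \oo, V (x (phi j)) /\ u j < a.
    by apply: filterI; [exact: xphi|exact: (cvgr_lt _ u_l)].
  move=> /filter_ex [j [/HV + uja]]; rewrite (f_fin hA (run_dom _)) lte_fin uE.
  by move=> /(lt_trans uja); rewrite ltxx.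
have fxs : edom f xs by apply: le_lt_trans fle _; exact: ltry.
have gxs : Omega g xs.
  apply/negP => /eqP g0; have := fh_gt0 hA g0; move: fle.
  by rewrite (f_fin hA fxs) -EFinD lee_fin lte_fin g0 mulr0 sub0r; lra.
split=> //; suff -> : Fval f h g xs = l by [].
have [U Uxs [L L0 HL]] := hf_lip fxs.
have u_f : u j @[j --> \oo] --> fine (f xs).
  apply/cvgrPdist_lt => e e0; near=> j.
  have Uj : U (x (phi j)) by near: j; exact: xphi.
  rewrite -uE; apply: le_lt_trans (HL _ _ (nbhs_singleton Uxs) fxs Uj (run_dom _)) _.
  rewrite mulrC -ltr_pdivlMr// enormB; near: j.
  by apply: (xphi (fun z => enorm (z - xs) < e / L)); apply/nbhs_enormP; exists (e / L) => //; rewrite divr_gt0.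
have E : fine (f xs) = l * g xs - h xs by exact: (cvg_unique _ u_f u_l).
by rewrite /Fval E subrK mulfK.
Unshelve. all: by end_near. Qed.

Variables (tau : R).
Hypothesis htau : 1 < tau.
Hypothesis dg_lip : exists2 U : set 'rV[R]_n, nbhs xs U &
  exists2 L : R, 0 < L & forall u v, U u -> Omega g u -> U v -> Omega g v ->
    enorm (dg u - dg v) <= L * enorm (u - v).
Hypothesis Phi_sub : forall u d t, Omega g u -> eps_subdiff 0 f u d -> 0 <= t ->
  frechet_subdiff (Phi f h g tau) (pt u t)
    (pt ((g u)^-1 *: (d + dh u - Fval f h g u *: dg u)) (t `^ (tau - 1))).

(* The coordinate [t] at which the last term of the potential equals [r], and the
   inexactness of the relative error bound. *)
Local Notation t := (fun k => (tau * r k) `^ tau^-1).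
Local Notation e := (fun k => Num.sqrt (eps k) + r k.+1 `^ (1 - tau^-1)).

Let tau0 : 0 < tau. Proof. exact: lt_trans ltr01 htau. Qed.

Lemma run_t_pow k : t k `^ tau / tau = r k.
Proof.
rewrite -powRrM mulVf ?gt_eqF// powRr1 ?mulr_ge0 ?(ltW tau0)//.
by rewrite mulrC mulKf// gt_eqF.
Qed.

Lemma run_t_slope k : t k `^ (tau - 1) = tau `^ (1 - tau^-1) * r k `^ (1 - tau^-1).
Proof.
rewrite -powRrM -powRM ?(ltW tau0)//; congr (_ `^ _).
by rewrite mulrBr mulVf ?gt_eqF// mulr1.
Qed.

(** Relative error bound: near the cluster point the potential has a subgradient
    at the next iterate whose size is controlled by the step and the errors. *)
Lemma run_subgradient_bound : exists rho C : R, [/\ 0 < rho, 0 < C &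
  forall k, delta k = 0 -> enorm (x k - xs) <= rho -> enorm (x k.+1 - xs) <= rho ->
  exists2 w, frechet_subdiff (Phi f h g tau) (pt (x k.+1) (t k.+1)) w &
    enorm w <= C * (enorm (s k) + e k)].
Proof.
have [fxs gxs _] := run_cluster_point.
have [U1 /nbhs_enormP [r1 r10 H1] [L1 L10 HL1]] := hf_lip fxs.
have [U2 /nbhs_enormP [r2 r20 H2] [L2 L20 HL2]] := dg_lip.
have gx0 := g_gt0 hA gxs fxs.
pose m := g xs / 2; have m0 : 0 < m by rewrite divr_gt0.
have [r3 r30 H3] : exists2 r : R, 0 < r & forall z, enorm (z - xs) < r -> m < g z.
  apply/(nbhs_enormP xs (fun z => m < g z)); apply: (cvgr_gt _ (g_continuous hA (x:=xs))).
  by rewrite /m; lra.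
have [M M0 HM] := run_g_bounded.
pose rho := Num.min r1 (Num.min r2 r3) / 2.
have rho0 : 0 < rho by rewrite divr_gt0// !lt_min r10 r20.
have rlt : rho < Num.min r1 (Num.min r2 r3) by rewrite /rho ltr_pdivrMr// ltr_pMr ?ltr1n// !lt_min r10 r20.
move: rlt; rewrite !lt_min => /and3P[rr1 rr2 rr3].
have Lh0 := Lh_gt0 hA.
have gh0 : 0 <= gam_hi by apply: le_trans hgam_le; exact: ltW.
(* Bounds valid in the ball: [al] for the quotient, [G] and [Hb] for the gradients,
   [LN] and [LF] for the Lipschitz constants of the numerator and the quotient. *)
pose al := c 0%N + r 0%N.
have al0 : 0 <= al by rewrite addr_ge0 ?run_Fval_ge0.
pose G := enorm (dg xs) + L2 * rho.
have G0 : 0 <= G by apply: addr_ge0; [exact: enorm_ge0|rewrite mulr_ge0// ltW].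
pose Hb := enorm (dh xs) + Lh * rho.
have Hb0 : 0 <= Hb by apply: addr_ge0; [exact: enorm_ge0|rewrite mulr_ge0// ltW].
pose LN := L1 + (Hb + Lh * rho).
have LN0 : 0 <= LN.
  apply: addr_ge0; first exact: ltW.
  by apply: addr_ge0 => //; rewrite mulr_ge0// ltW.
pose LF := (LN + al * G) / m.
have LF0 : 0 <= LF by rewrite divr_ge0 ?(ltW m0)// addr_ge0// mulr_ge0.
pose K1 := Num.sqrt M; pose K2 := Lh + al * L2 + LF * G + gam_hi.
have K10 : 0 <= K1 by exact: sqrtr_ge0.
have K20 : 0 <= K2.
  apply: addr_ge0 => //; apply: addr_ge0; last exact: mulr_ge0.
  by apply: addr_ge0; [exact: ltW|rewrite mulr_ge0// ltW].
pose T := tau `^ (1 - tau^-1).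
have T0 : 0 <= T by exact: powR_ge0.
pose C := K1 / m + K2 / m + T + 1.
have C0 : 0 < C by rewrite ltr_wpDl// !addr_ge0// divr_ge0// ltW.
exists rho, C; split=> // k dk0 b0 b1.
have [d dsub De] := step k; rewrite dk0 in dsub.
have tk0 : 0 <= t k.+1 by exact: powR_ge0.
have Hsub := Phi_sub (run_Omega k.+1) dsub tk0.
eexists; first exact: Hsub.
set N := enorm (s k); have N0 : 0 <= N by exact: enorm_ge0.
have N2 : N <= 2 * rho.
  apply: le_trans (enorm_triangle _ xs _) _; rewrite (enormB xs); lra.
have U1k : U1 (x k) by apply: H1; apply: le_lt_trans rr1.
have U1k1 : U1 (x k.+1) by apply: H1; apply: le_lt_trans rr1.
have U2k : U2 (x k) by apply: H2; apply: le_lt_trans rr2.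
have U2k1 : U2 (x k.+1) by apply: H2; apply: le_lt_trans rr2.
have U2s : U2 xs by apply: H2; rewrite subrr enorm0.
have gk : m < g (x k) by apply: H3; apply: le_lt_trans rr3.
have gk1 : m < g (x k.+1) by apply: H3; apply: le_lt_trans rr3.
have dgb z : U2 z -> Omega g z -> enorm (z - xs) <= rho -> enorm (dg z) <= G.
  move=> Uz gz zr; rewrite -[dg z](subrKC (dg xs)).
  apply: le_trans (enormD _ _) _; rewrite lerD2l.
  by apply: le_trans (HL2 _ _ Uz gz U2s gxs) _; rewrite ler_pM2l.
have dhb z : enorm (z - xs) <= rho -> enorm (dh z) <= Hb.
  move=> zr; rewrite -[dh z](subrKC (dh xs)).
  apply: le_trans (enormD _ _) _; rewrite lerD2l.
  by apply: le_trans (dh_lip _ _) _; rewrite ler_pM2l.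
have fk : `|fine (f (x k.+1)) - fine (f (x k))| <= L1 * N.
  exact: HL1 (run_dom _) U1k (run_dom _).
have hup u v : enorm (v - u) = N -> enorm (dh u) <= Hb -> h v - h u <= (Hb + Lh * rho) * N.
  move=> En Eu; apply: le_trans (h_up u v) _; rewrite En mulrDl; apply: lerD.
    apply: le_trans (ler_norm _) _; apply: le_trans (dot_le _ _) _.
    by rewrite En ler_wpM2r.
  by rewrite expr2 mulrA ler_wpM2r// mulrAC ler_pdivrMr// -mulrA ler_pM2l// mulrC.
have hk : `|h (x k.+1) - h (x k)| <= (Hb + Lh * rho) * N.
  rewrite ler_norml hup ?dhb// andbT.
  have := hup (x k.+1) (x k); rewrite enormB => /(_ erefl (dhb _ b1)).
  by move: (h (x k.+1)) (h (x k)) ((Hb + Lh * rho) * N) => a b q; lra.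
have yk j z : enorm (dg (x j)) <= G -> `|dot (y j) z| <= G * enorm z.
  move=> Gj; apply: le_trans (dot_le _ _) _; rewrite dgP ler_wpM2r ?enorm_ge0//.
have Gk := dgb _ U2k (run_Omega _) b0; have Gk1 := dgb _ U2k1 (run_Omega _) b1.
have gkk : `|g (x k.+1) - g (x k)| <= G * N.
  have a1 := run_g_subgradient k (x k.+1); have a2 := run_g_subgradient k.+1 (x k).
  have := yk k (x k.+1 - x k) Gk; have := yk k.+1 (x k - x k.+1) Gk1.
  rewrite (enormB (x k)) -/N !ler_norml => /andP[q1 q2] /andP[q3 q4].
  move: a1 a2 q1 q2 q3 q4; move: (dot _ _) (dot _ _) => p1 p2 *.
  by apply/andP; split; lra.
have Fk : `|c k.+1 - c k| <= LF * N.
  have al1 : c k <= al by exact: run_Fval_le.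
  have c0 := run_Fval_ge0 k.
  have E0 := run_FvalE k; have E1 := run_FvalE k.+1.
  rewrite /LF mulrAC ler_pdivlMr//.
  apply: (@le_trans _ _ (`|c k.+1 - c k| * g (x k.+1))).
    by rewrite ler_wpM2l// ltW.
  rewrite -(gtr0_norm (run_g_gt0 k.+1)) -normrM.
  have -> : (c k.+1 - c k) * g (x k.+1) =
    (fine (f (x k.+1)) - fine (f (x k))) + (h (x k.+1) - h (x k))
      - c k * (g (x k.+1) - g (x k)) by move: E0 E1 => /=; lra.
  apply: le_trans (ler_normB _ _) _; rewrite mulrDl; apply: lerD.
    by apply: le_trans (ler_normD _ _) _; rewrite /LN mulrDl; exact: lerD.
  by rewrite normrM (ger0_norm c0) -[leRHS]mulrA; apply: ler_pM.
set q := Num.sqrt (eps k); have q0 : 0 <= q by exact: sqrtr_ge0.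
have Dk : enorm (Delta k) <= K1 * q.
  rewrite /K1 /q -sqrtrM ?(ltW M0)// -[leLHS]ger0_norm ?enorm_ge0// -sqrtr_sqr ler_wsqrtr//.
  have := x_error hx k; have := delta_ge0 hx k.
  have : eps k * g (x k.+1) <= M * eps k by rewrite mulrC ler_wpM2r ?(eps_ge0 hx).
  have := normr_ge0 (dot (Delta k) (s k)); lra.
have HHk : enorm (s k *m H k) <= gam_hi * N.
  have [sH pH] := H_posdef hx k.
  apply: (enorm_mulmx_le _ sH _ gh0); last exact: (hH k).2.
  move=> u; have [->|/pH/ltW//] := eqVneq u 0.
  by rewrite mul0mx dot0l.
set v := d + dh (x k.+1) - _ *: _.
have vE : v = Delta k + (dh (x k.+1) - dh (x k)) + c k *: (dg (x k) - dg (x k.+1))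
    + (c k - c k.+1) *: dg (x k.+1) - s k *m H k.
  rewrite /v De dgP scalerBr scalerBl; move: (s k *m H k) => z.
  move: (c k *: dg (x k)) (c k *: dg (x k.+1)) (c k.+1 *: _) (dh _) (dh _) => v1 v2 v3 v4 v5.
  by apply/rowP => i; rewrite !mxE; ring.
have vb : enorm v <= K1 * q + K2 * N.
  rewrite vE; apply: le_trans (enormD _ _) _; rewrite enormN.
  apply: le_trans (lerD (enormD _ _) HHk) _.
  apply: le_trans (lerD (lerD (enormD _ _) (lexx _)) (lexx _)) _.
  apply: le_trans (lerD (lerD (lerD (enormD _ _) (lexx _)) (lexx _)) (lexx _)) _.
  rewrite !enormZ.
  have z1 : enorm (dh (x k.+1) - dh (x k)) <= Lh * N by exact: dh_lip.
  have z2 : `|c k| * enorm (dg (x k) - dg (x k.+1)) <= al * (L2 * N).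
    apply: ler_pM; rewrite ?normr_ge0 ?enorm_ge0//.
      by rewrite ger0_norm ?run_Fval_ge0//; exact: run_Fval_le.
    by rewrite /N (enormB (x k.+1)); apply: HL2 => //; exact: run_Omega.
  have z3 : `|c k - c k.+1| * enorm (dg (x k.+1)) <= LF * N * G.
    by rewrite distrC; apply: ler_pM; rewrite ?normr_ge0 ?enorm_ge0.
  rewrite /K2; lra.
apply: le_trans (enorm_pt_le _ _) _.
rewrite [`|_ `^ _|]ger0_norm ?powR_ge0// run_t_slope -/T.
set rr := r k.+1 `^ _; have rr0 : 0 <= rr by exact: powR_ge0.
have vg : enorm ((g (x k.+1))^-1 *: v) <= K1 / m * q + K2 / m * N.
  rewrite enormZ gtr0_norm ?invr_gt0 ?run_g_gt0//.
  apply: (@le_trans _ _ (m^-1 * (K1 * q + K2 * N))).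
    apply: ler_pM; rewrite ?invr_ge0 ?enorm_ge0 ?(ltW (run_g_gt0 _))//.
    by rewrite lef_pV2 ?posrE ?run_g_gt0// ltW.
  by move: m^-1 => im; lra.
have w0 : 0 <= N + (q + rr) by rewrite !addr_ge0.
have qw : q <= N + (q + rr) by rewrite addrCA lerDl addr_ge0.
have Nw : N <= N + (q + rr) by rewrite lerDl addr_ge0.
have rw : rr <= N + (q + rr) by rewrite addrA lerDr addr_ge0.
have k1 : K1 / m * q <= K1 / m * (N + (q + rr)).
  by apply: ler_wpM2l qw; apply: divr_ge0 => //; exact: ltW.
have k2 : K2 / m * N <= K2 / m * (N + (q + rr)).
  by apply: ler_wpM2l Nw; apply: divr_ge0 => //; exact: ltW.
have k3 : T * rr <= T * (N + (q + rr)) by exact: ler_wpM2l rw.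
rewrite /C; lra.
Qed.

(** The run of the algorithm near a cluster point, seen through its potential, is
    an inexact descent sequence in the sense of [kl_descent]. *)
Lemma run_kl_descent (theta : R) : (exists K0, forall k, (K0 <= k)%N -> delta k = 0) ->
  e k @[k --> \oo] --> 0 -> KL_function (Phi f h g tau) theta ->
  exists sigma C rho K, kl_descent (fun k => enorm (x k - xs)) (fun k => enorm (s k))
    e (fun k => c k + r k - Fval f h g xs) theta sigma C rho K.
Proof.
move=> [K0 HK0] e_cvg0 KL.
have [fxs gxs pot] := run_cluster_point.
have [sigma sg0 desc] := run_potential_descent.
have [rho [C [rho0 C0 bound]]] := run_subgradient_bound.
have noninc : nonincreasing_seq (fun k => c k + r k).
  apply/nonincreasing_seqP => k; apply: le_trans (desc k).
  by rewrite lerDl mulr_ge0 ?sqr_ge0// ltW.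
have A_ge0 k : 0 <= c k + r k - Fval f h g xs.
  rewrite subr_ge0 -(cvg_lim (@Rhausdorff R) pot).
  by apply: nonincreasing_cvgn_ge noninc _ _; apply/cvg_ex; exists (Fval f h g xs).
have A_cvg0 : c k + r k - Fval f h g xs @[k --> \oo] --> 0.
  by rewrite -[X in _ --> X](subrr (Fval f h g xs)); apply: cvgB pot _; exact: cvg_cst.
have s_cvg0 : enorm (s k) @[k --> \oo] --> 0.
  apply: (cvg0_sqr sg0 _ A_ge0) A_cvg0 => k; first exact: enorm_ge0.
  by have := A_ge0 k.+1; have := desc k; lra.
have t_cvg0 : t k.+1 @[k --> \oo] --> 0.
  apply: cvg0_powR; first by rewrite invr_gt0.
    by move=> k; rewrite mulr_ge0// ltW.
  rewrite -[X in _ --> X](mulr0 tau); apply: cvgM; first exact: cvg_cst.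
  by rewrite (cvg_shiftS r).
have t_ge0 k : 0 <= t k by exact: powR_ge0.
have PhiEk k : Phi f h g tau (pt (x k) (t k)) = (c k + r k)%:E.
  by rewrite (Phi_fin hA _ (run_Omega k) (run_dom k))// run_t_pow.
have Phixs : Phi f h g tau (pt xs 0) = (Fval f h g xs)%:E.
  by rewrite (Phi_fin hA _ gxs fxs)// powR0 ?gt_eqF// mul0r addr0.
have next k : enorm (x k.+1 - xs) <= enorm (x k - xs) + enorm (s k).
  by rewrite [leRHS]addrC; exact: enorm_triangle.
have ptd k : enorm (pt (x k.+1) (t k.+1) - pt xs 0) <= enorm (x k.+1 - xs) + t k.+1.
  rewrite ptB; apply: le_trans (enorm_pt_le _ _) _.
  by rewrite subr0 ger0_norm.
(* Zero is a limiting subgradient of the potential at the cluster point, so the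
   KL inequality is available there. *)
have crit : dom_subdiff (Phi f h g tau) (pt xs 0).
  have rho2 : 0 < rho / 2 by rewrite divr_gt0.
  have /cvgr0Pnorm_lt/(_ _ rho2) [N _ HN] := s_cvg0.
  have [|phi Hphi xphi] := @run_subsequence (fun k => [/\ delta k = 0,
    enorm (x k - xs) <= rho & enorm (x k.+1 - xs) <= rho]) _.
    exists (rho / 2) => //; exists (maxn K0 N) => k; rewrite geq_max => /andP[k1 k2] xk.
    have sk : enorm (s k) < rho / 2 by apply: le_lt_trans (ler_norm _) _; exact: HN.
    by split; [exact: HK0|lra|have := next k; lra].
  have phioo : phi j @[j --> \oo] --> \oo by apply: cvg_ge_id => j; have [] := Hphi j.
  have /choice [w Hw] : forall j, exists w,
      frechet_subdiff (Phi f h g tau) (pt (x (phi j).+1) (t (phi j).+1)) w /\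
      enorm w <= C * (enorm (s (phi j)) + e (phi j)).
    move=> j; have [_ [d0 d1 d2]] := Hphi j.
    by have [w] := bound _ d0 d1 d2; exists w.
  have dphi : enorm (x (phi j) - xs) @[j --> \oo] --> 0.
    apply/cvgr0Pnorm_lt => d d0.
    have xd : nbhs xs (fun z => enorm (z - xs) < d) by apply/nbhs_enormP; exists d.
    have [J _ HJ] := xphi _ xd; exists J => // j /= /HJ /=.
    by rewrite ger0_norm ?enorm_ge0.
  have sphi : enorm (s (phi j)) @[j --> \oo] --> 0 := cvg_comp phi _ phioo s_cvg0.
  have ephi : e (phi j) @[j --> \oo] --> 0 := cvg_comp phi _ phioo e_cvg0.
  have tphi : t (phi j).+1 @[j --> \oo] --> 0 := cvg_comp phi _ phioo t_cvg0.
  exists 0; split; first by rewrite Phixs.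
  exists (fun j => pt (x (phi j).+1) (t (phi j).+1)), w; split.
  - by move=> j; have [] := Hw j.
  - apply: (enorm_cvg0 (b := fun j => enorm (x (phi j) - xs) + enorm (s (phi j)) + t (phi j).+1)).
      by move=> j; apply: le_trans (ptd _) _; rewrite lerD2r.
    by rewrite -[X in _ --> X](addr0 0) -{1}(addr0 0); do 2 apply: cvgD => //.
  - rewrite Phixs; under eq_fun do rewrite PhiEk.
    apply: cvg_EFin; first exact: nearW.
    apply: (cvg_comp (fun j => (phi j).+1) (fun k => c k + r k)) pot.
    by apply: cvg_ge_id => j; apply: leqW; have [] := Hphi j.
  - apply: (enorm_cvg0 (b := fun j => C * (enorm (s (phi j)) + e (phi j)))).
      by move=> j; rewrite subr0; have [] := Hw j.
    rewrite -[X in _ --> X](mulr0 C); apply: cvgM; first exact: cvg_cst.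
    by rewrite -[X in _ --> X](addr0 0); exact: cvgD.
have [a [mu [nu [a0 mu0 nu0 KLin]]]] := KL _ crit.
have mu2 : 0 < mu / 2 by rewrite divr_gt0.
have /cvgr0Pnorm_lt/(_ _ mu2) [N1 _ HN1] := t_cvg0.
have /cvgr0Pnorm_lt/(_ _ nu0) [N2 _ HN2] := A_cvg0.
exists sigma, (C / a), (Num.min rho (mu / 2)), (maxn K0 (maxn N1 N2)).
split=> //; rewrite ?divr_gt0 ?lt_min ?rho0//.
- by move=> k; rewrite enorm_ge0.
- by move=> k; rewrite enorm_ge0.
- by move=> k; rewrite addr_ge0 ?sqrtr_ge0 ?powR_ge0.
- by move=> k; have := desc k; lra.
- by move=> k; rewrite [leRHS]addrC (enormB (x k.+1) (x k)); exact: enorm_triangle.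
move=> k; rewrite !geq_max => /and3P[k0 k1 k2].
rewrite !le_min => /andP[d1 d2] /andP[d3 d4] Ap.
have [w Hw wb] := bound k (HK0 _ k0) d1 d3.
have tk : t k.+1 < mu / 2 by apply: le_lt_trans (ler_norm _) _; exact: HN1.
have Ak : c k.+1 + r k.+1 - Fval f h g xs < nu.
  by apply: le_lt_trans (ler_norm _) _; apply: HN2; exact: leqW.
have lw : limiting_subdiff (Phi f h g tau) (pt (x k.+1) (t k.+1)) w.
  exact: frechet_limiting.
have near : enorm (pt (x k.+1) (t k.+1) - pt xs 0) <= mu.
  by apply: le_trans (ptd k) _; lra.
have := KLin (pt (x k.+1) (t k.+1)) (ex_intro _ w lw) near.
rewrite PhiEk Phixs -EFinD !lte_fin => /(_ _ _) dist_le.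
have {}dist_le : a * (c k.+1 + r k.+1 - Fval f h g xs) `^ theta <= enorm w.
  rewrite -lee_fin; apply: le_trans (dist_le _ _) _; [lra|lra|].
  by apply: ereal_inf_lbound; exists w => //; rewrite sub0r enormN.
by rewrite mulrAC ler_pdivlMr// mulrC (le_trans dist_le).
Qed.

End cluster_point.

End majorant.

End run.

(** * Majorants of the error series *)

(** [r] majorizes the tails of the series of the [eps k], and [E] the tails of the
    series of the resulting inexactness terms in the relative error bound. *)
Record error_majorants (R : realType) (eps : nat -> R) (tau : R) (r E : nat -> R)
    : Prop := {
  maj_r_ge0 : forall k, 0 <= r k;
  maj_r_dec : forall k, r k.+1 + eps k <= r k;
  maj_r_cvg0 : r k @[k --> \oo] --> 0;
  maj_E_ge0 : forall k, 0 <= E k;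
  maj_E_dec : forall k,
    E k.+1 + (Num.sqrt (eps k) + r k.+1 `^ (1 - tau^-1)) <= E k;
  maj_E_cvg0 : E k @[k --> \oo] --> 0
}.

Lemma maj_error_cvg0 (R : realType) (eps : nat -> R) tau r E :
  error_majorants eps tau r E ->
  Num.sqrt (eps k) + r k.+1 `^ (1 - tau^-1) @[k --> \oo] --> 0.
Proof.
move=> H; apply: cvg0_majorant (maj_E_cvg0 H) => k.
rewrite addr_ge0 ?sqrtr_ge0 ?powR_ge0//=.
by have := maj_E_dec H k; have := maj_E_ge0 H k.+1; lra.
Qed.

Lemma series_tails (R : realType) (u : nat -> R) : (forall k, 0 <= u k) ->
  (\sum_(0 <= k <oo) (u k)%:E < +oo)%E ->
  exists2 r : nat -> R, forall k, (r k)%:E = (\sum_(k <= i <oo) (u i)%:E)%E &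
    [/\ forall k, 0 <= r k, forall k, r k.+1 + u k = r k & r k @[k --> \oo] --> 0].
Proof.
move=> u0 usum.
have ue0 k : (0 <= (u k)%:E)%E by rewrite lee_fin.
have T0 k : (0 <= \sum_(k <= i <oo) (u i)%:E)%E by apply: nneseries_ge0.
have rec k : (\sum_(k <= i <oo) (u i)%:E = (u k)%:E + \sum_(k.+1 <= i <oo) (u i)%:E)%E.
  by rewrite (@nneseries_split _ _ k 1)// addn1 big_nat1.
have Tfin k : (\sum_(k <= i <oo) (u i)%:E < +oo)%E.
  elim: k => // k; apply: le_lt_trans; rewrite [leRHS]rec.
  by rewrite leeDr.
have TE k : (fine (\sum_(k <= i <oo) (u i)%:E))%:E = (\sum_(k <= i <oo) (u i)%:E)%E.
  by rewrite fineK// ge0_fin_numE.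
exists (fun k => fine (\sum_(k <= i <oo) (u i)%:E)) => //; split.
- by move=> k; rewrite -lee_fin TE.
- by move=> k; apply: EFin_inj; rewrite EFinD !TE [RHS]rec addeC.
- apply: fine_cvg; apply: (@nneseries_tail_cvg _ (fun k => (u k)%:E) xpredT) => // k _.
Qed.

Lemma series_majorants (R : realType) (eps : nat -> R) (tau : R) :
  1 < tau -> (forall k, 0 <= eps k) ->
  (\sum_(0 <= k <oo) (eps k)%:E < +oo)%E ->
  (\sum_(0 <= k <oo) (Num.sqrt (eps k))%:E < +oo)%E ->
  (\sum_(0 <= k <oo)
      poweR (\sum_(k <= i <oo) (eps i)%:E) (1 - tau^-1)%R < +oo)%E ->
  exists r E, error_majorants eps tau r E.
Proof.
move=> tau1 eps0 s1 s2 s3.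
have [r rE [r0 rdec rc]] := series_tails eps0 s1.
have [E1 _ [E10 E1dec E1c]] := series_tails (fun k => sqrtr_ge0 (eps k)) s2.
have s4 : (\sum_(0 <= k <oo) (r k `^ (1 - tau^-1))%:E < +oo)%E.
  apply: le_lt_trans s3; rewrite le_eqVlt; apply/orP; left; apply/eqP.
  by apply: eq_eseriesr => k _; rewrite -rE poweR_EFin.
have [E2 _ [E20 E2dec E2c]] := series_tails (fun k => powR_ge0 (r k) _) s4.
exists r, (fun k => E1 k + E2 k); split=> //.
- by move=> k; rewrite rdec.
- by move=> k; rewrite addr_ge0.
- move=> k; rewrite -(E1dec k) -(E2dec k).
  have : r k.+1 `^ (1 - tau^-1) <= r k `^ (1 - tau^-1).
    have w0 : 0 <= 1 - tau^-1 by rewrite subr_ge0 invf_le1 ?ltW// (lt_trans ltr01).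
    by rewrite ge0_ler_powR ?nnegrE// -(rdec k) lerDl.
  lra.
- by rewrite -[X in _ --> X](addr0 0); exact: cvgD.
Qed.

(** Errors of order [k ^ (- q)]: the tails are of order [k ^ (- (q - 1))], and [p] is
    any common lower bound on the decay exponents of the two error terms. *)
Lemma poly_majorants (R : realType) (eps : nat -> R) (tau q p : R) :
  1 < tau -> 0 < eps 0%N -> (forall k, eps k = eps 0%N / (k.+1%:R `^ q)) ->
  1 < p -> p <= q / 2 -> p <= (q - 1) * (1 - tau^-1) ->
  exists r E Ce CE, [/\ error_majorants eps tau r E,
    forall k, Num.sqrt (eps k) + r k.+1 `^ (1 - tau^-1) <= Ce * k.+1%:R `^ (- p) &
    forall k, E k <= CE * k.+1%:R `^ (- (p - 1))].
Proof.
move=> tau1 e0 epsE p1 pq1 pq2.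
have q1 : 1 < q by lra.
have w0 : 0 <= 1 - tau^-1 by rewrite subr_ge0 invf_le1 ?ltW// (lt_trans ltr01).
pose cr := eps 0%N * (2 `^ q / (q - 1)).
have cr0 : 0 < cr by rewrite mulr_gt0// divr_gt0 ?powR_gt0// subr_gt0.
pose Ce := Num.sqrt (eps 0%N) + cr `^ (1 - tau^-1).
have Ce0 : 0 <= Ce by rewrite addr_ge0 ?sqrtr_ge0 ?powR_ge0.
pose CE := Ce * (2 `^ p / (p - 1)).
have CE0 : 0 <= CE by rewrite mulr_ge0// divr_ge0 ?powR_ge0// subr_ge0 ltW.
pose r (k : nat) := cr * k.+1%:R `^ (- (q - 1)).
have eb k : Num.sqrt (eps k) + r k.+1 `^ (1 - tau^-1) <= Ce * k.+1%:R `^ (- p).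
  rewrite mulrDl; apply: lerD.
    rewrite epsE -powRN sqrtrM ?(ltW e0)// ler_wpM2l ?sqrtr_ge0//.
    by rewrite -powR12_sqrt ?powR_ge0// -powRrM mulNr natr_powRN_le.
  rewrite powRM ?powR_ge0 ?(ltW cr0)// ler_wpM2l ?powR_ge0// -powRrM mulNr.
  apply: (@le_trans _ _ (k.+2%:R `^ (- p))); first exact: natr_powRN_le.
  rewrite !powRN lef_pV2 ?posrE ?powR_gt0//.
  by rewrite ge0_ler_powR ?nnegrE ?ler_nat//; lra.
exists r, (fun k => CE * k.+1%:R `^ (- (p - 1))), Ce, CE; split=> //; split.
- by move=> k; rewrite mulr_ge0 ?powR_ge0 ?(ltW cr0).
- move=> k; have := natr_powRN_telescope k q1.
  rewrite -(ler_pM2l cr0) mulrDr; apply: le_trans; rewrite lerD2l epsE powRN.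
  rewrite mulrA ler_wpM2r ?invr_ge0 ?powR_ge0//.
  suff -> : cr * ((q - 1) / 2 `^ q) = eps 0%N by [].
  by rewrite /cr; field; rewrite subr_eq0 !gt_eqF// powR_gt0.
- rewrite -[X in _ --> X](mulr0 cr); apply: cvgM; first exact: cvg_cst.
  by apply: cvg0_invpow; rewrite subr_gt0.
- by move=> k; rewrite mulr_ge0 ?powR_ge0.
- move=> k; have := natr_powRN_telescope k p1.
  move=> /(ler_wpM2l CE0); rewrite mulrDr; apply: le_trans; rewrite lerD2l.
  apply: le_trans (eb k) _; rewrite mulrA ler_wpM2r ?powR_ge0//.
  suff -> : CE * ((p - 1) / 2 `^ p) = Ce by [].
  by rewrite /CE; field; rewrite subr_eq0 !gt_eqF// powR_gt0.
- rewrite -[X in _ --> X](mulr0 CE); apply: cvgM; first exact: cvg_cst.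
  by apply: cvg0_invpow; rewrite subr_gt0.
Qed.

Lemma cvg0_geometric (R : realType) (c z : R) : 0 < z < 1 ->
  c * z ^+ k @[k --> \oo] --> 0.
Proof.
move=> /andP[z0 z1]; rewrite -[X in _ --> X](mulr0 c).
by apply: cvgM; [exact: cvg_cst|apply: cvg_expr; rewrite ger0_norm// ltW].
Qed.

(** Geometric errors have geometric majorants. *)
Lemma geometric_majorants (R : realType) (eps : nat -> R) (tau zeta : R) :
  1 < tau -> 0 < zeta < 1 -> 0 < eps 0%N -> (forall k, eps k = eps 0%N * zeta ^+ k) ->
  exists z r E Ce CE, [/\ 0 < z < 1, 0 <= Ce, 0 <= CE & [/\ error_majorants eps tau r E,
    forall k, Num.sqrt (eps k) + r k.+1 `^ (1 - tau^-1) <= Ce * z ^+ k &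
    forall k, E k <= CE * z ^+ k]].
Proof.
move=> tau1 /andP[z0 z1] e0 epsE.
have tau0 : 0 < tau by lra.
have w0 : 0 < 1 - tau^-1 by rewrite subr_gt0 invf_lt1.
have d0 : 0 < 1 - zeta by rewrite subr_gt0.
pose cr := eps 0%N / (1 - zeta); have cr0 : 0 < cr by rewrite divr_gt0.
pose z := Num.max (Num.sqrt zeta) (zeta `^ (1 - tau^-1)).
have sz0 : 0 < Num.sqrt zeta by rewrite sqrtr_gt0.
have zp : 0 < z by rewrite lt_max sz0.
have zl : z < 1.
  rewrite gt_max -{1}sqrtr1 ltr_sqrt// z1 /=.
  have : zeta `^ (1 - tau^-1) < 1 `^ (1 - tau^-1) by rewrite gt0_ltr_powR// nnegrE ltW.
  by rewrite powR1.
have z01 : 0 < z < 1 by rewrite zp.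
have dz0 : 0 < 1 - z by rewrite subr_gt0.
pose Ce := Num.sqrt (eps 0%N) + cr `^ (1 - tau^-1).
have Ce0 : 0 <= Ce by rewrite addr_ge0 ?sqrtr_ge0 ?powR_ge0.
pose CE := Ce / (1 - z); have CE0 : 0 <= CE by rewrite divr_ge0// ltW.
pose r k := cr * zeta ^+ k.
have r0 k : 0 <= r k by rewrite mulr_ge0 ?exprn_ge0 ?ltW.
have eb k : Num.sqrt (eps k) + r k.+1 `^ (1 - tau^-1) <= Ce * z ^+ k.
  rewrite mulrDl; apply: lerD.
    rewrite epsE sqrtrM ?(ltW e0)// ler_wpM2l ?sqrtr_ge0//.
    have -> : Num.sqrt (zeta ^+ k) = Num.sqrt zeta ^+ k.
      by rewrite -!powR12_sqrt ?exprn_ge0 ?(ltW z0)// powR_expn// ltW.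
    by apply: lerXn2r; rewrite ?nnegrE ?(ltW zp) ?(ltW sz0)// le_max lexx.
  rewrite powRM ?exprn_ge0 ?(ltW z0) ?(ltW cr0)// ler_wpM2l ?powR_ge0//.
  rewrite powR_expn ?(ltW z0)//.
  have zz : zeta `^ (1 - tau^-1) <= z by rewrite le_max lexx orbT.
  apply: (@le_trans _ _ (z ^+ k.+1)); first by apply: lerXn2r; rewrite ?nnegrE ?powR_ge0 ?(ltW zp).
  by rewrite exprS ler_piMl ?exprn_ge0 ?ltW.
exists z, r, (fun k => CE * z ^+ k), Ce, CE; split=> //; split=> //; split=> //.
- move=> k; rewrite le_eqVlt; apply/orP; left; apply/eqP.
  by rewrite epsE /r exprS /cr; field; rewrite gt_eqF.
- by apply: cvg0_geometric; rewrite z0.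
- by move=> k; rewrite mulr_ge0 ?exprn_ge0 ?(ltW zp).
- move=> k; have -> : CE * z ^+ k = CE * z ^+ k.+1 + Ce * z ^+ k.
    by rewrite /CE exprS; field; rewrite gt_eqF.
  by rewrite lerD2l.
- exact: cvg0_geometric.
Qed.

(** A geometric sequence decays faster than any power. *)
Lemma geometric_le_powR (R : realType) (z a : R) : 0 < z < 1 -> 0 < a ->
  exists2 C : R, 0 < C & forall k : nat, z ^+ k <= C * k.+1%:R `^ (- a).
Proof.
move=> /andP[z0 z1] a0.
pose w := z `^ a^-1; have w0 : 0 < w by rewrite powR_gt0.
have w1 : w < 1.
  have : z `^ a^-1 < 1 `^ a^-1 by rewrite gt0_ltr_powR ?invr_gt0// nnegrE ltW.
  by rewrite powR1.
pose d := Num.min 1 (w^-1 - 1).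
have d0 : 0 < d by rewrite lt_min ltr01 subr_gt0 invf_gt1.
have dk k : d * k.+1%:R * w ^+ k <= 1.
  rewrite -ler_pdivlMr ?exprn_gt0// div1r -exprVn.
  elim: k => [|k IH]; first by rewrite mulr1 expr0 ge_min lexx.
  rewrite exprS -natr1 mulrDr mulr1.
  have d1 : d <= w^-1 - 1 by rewrite ge_min lexx orbT.
  have e1 : 1 <= w^-1 ^+ k by rewrite exprn_ege1// invf_ge1// ltW.
  have : d * 1 <= (w^-1 - 1) * w^-1 ^+ k by apply: ler_pM => //; exact: ltW.
  move: (w^-1) (w^-1 ^+ k) IH => v vk IH; lra.
exists ((d^-1) `^ a); first by rewrite powR_gt0 ?invr_gt0.
move=> k; have -> : z ^+ k = (w ^+ k) `^ a.
  by rewrite powR_expn ?(ltW w0)// /w -powRrM mulVf ?gt_eqF// powRr1// ltW.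
have -> : k.+1%:R `^ (- a) = (k.+1%:R^-1) `^ a :> R.
  by rewrite -(@powR_inv1 _ k.+1%:R)// -powRrM mulN1r.
rewrite -powRM ?invr_ge0 ?(ltW d0)//.
rewrite ge0_ler_powR ?(ltW a0) ?nnegrE ?exprn_ge0 ?mulr_ge0 ?invr_ge0 ?(ltW w0) ?(ltW d0)//.
by rewrite -invfM -div1r ler_pdivlMr ?mulr_gt0// mulrC.
Qed.

(** * The convergence theorem *)

(** A polynomial rate follows from any KL exponent not above the one that matches the
    decay [k ^ (- p)] of the errors. *)
Lemma kl_poly_rate_le (R : realType) (dist s e A E : nat -> R)
    (p theta sigma C rho Ce CE : R) K0 : 1 < p -> p * (2 * theta - 1) <= theta ->
  kl_descent dist s e A theta sigma C rho K0 ->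
  (forall k, 0 <= E k) -> (forall k, E k.+1 + e k <= E k) ->
  E k @[k --> \oo] --> 0 ->
  (forall k, e k <= Ce * k.+1%:R `^ (- p)) ->
  (forall k, E k <= CE * k.+1%:R `^ (- (p - 1))) ->
  eventually_O dist (fun k => k%:R `^ (- (p - 1))).
Proof.
move=> p1 pth H E0 Edec Ec eb Eb.
have th : theta <= p / (2 * p - 1) by rewrite ler_pdivlMr; lra.
have [K1 H1] := kl_descent_weaken th H.
exact: (kl_poly_rate p1 H1 E0 Edec Ec eb Eb).
Qed.

Unset Implicit Arguments.
Set Strict Implicit.
Set Printing Implicit Defensive.

Theorem theorem4p2 (R : realType) (n : nat)
  (f : 'rV[R]_n -> \bar R) (h g : 'rV[R]_n -> R) (Lh : R)
  (eps : nat -> R) (H : nat -> 'M[R]_n)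
  (x y Delta : nat -> 'rV[R]_n) (delta : nat -> R)
  (gam_lo gam_hi tau theta : R)
  (hA : standing_assumptions f h g Lh)
  (* (1) *)
  (hf_lip : forall x0 : 'rV[R]_n, edom f x0 ->
     exists2 O : set 'rV[R]_n, nbhs x0 O &
     exists2 L : R, 0 < L &
       forall u v, O u -> edom f u -> O v -> edom f v ->
         `|fine (f u) - fine (f v)| <= L * enorm (u - v))
  (* (2) *)
  (hg_diff : forall x0 : 'rV[R]_n, Omega g x0 -> differentiable g x0)
  (hg_C1 : forall x0 : 'rV[R]_n, Omega g x0 -> {for x0, continuous (grad g)})
  (hg_lip : forall x0 : 'rV[R]_n, Omega g x0 ->
     exists2 O : set 'rV[R]_n, nbhs x0 O &
     exists2 L : R, 0 < L &
       forall u v, O u -> Omega g u -> O v -> Omega g v ->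
         enorm (grad g u - grad g v) <= L * enorm (u - v))
  (* (3) *)
  (hx : iVPGSA f h g eps H x y Delta delta)
  (hdelta : exists K0 : nat, (0 < K0)%N /\
     forall k, (K0 <= k)%N -> delta k = 0)
  (* (4) *)
  (hgam : 0 < gam_lo /\ 0 < gam_hi)
  (hgam_Lh : Lh / 2 < gam_lo)
  (hgam_le : gam_lo <= gam_hi)
  (hH : forall k, loewner_le gam_lo%:M (H k) /\ loewner_le (H k) gam_hi%:M)
  (* (5) *)
  (htau : 1 < tau)
  (hsum : (\sum_(0 <= k <oo) (eps k)%:E < +oo)%E)
  (hsum_sqrt : (\sum_(0 <= k <oo) (Num.sqrt (eps k))%:E < +oo)%E)
  (hsum_tail : (\sum_(0 <= k <oo)
      poweR (\sum_(k <= i <oo) (eps i)%:E) (1 - tau^-1)%R < +oo)%E)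
  (* (6) *)
  (htheta : 0 <= theta < 1)
  (hKL : KL_function (Phi f h g tau) theta) :
  exists2 xs : 'rV[R]_n, x k @[k --> \oo] --> xs &
  [/\ (* (i) *)
      theta = 0 -> \forall k \near \oo, x k = xs,
      (* (ii) *)
      0 < theta <= 1 / 2 ->
      (forall zeta : R, 0 < zeta < 1 -> 0 < eps 0%N ->
         (forall k, eps k = eps 0%N * zeta ^+ k) ->
         exists2 rho : R, 0 < rho < 1 &
           eventually_O (fun k => enorm (x k - xs)) (fun k => rho ^+ k))
      /\
      (forall q : R, (2 * tau - 1) / (tau - 1) < q -> 0 < eps 0%N ->
         (forall k, eps k = eps 0%N / (k.+1%:R `^ q)) ->
         [/\ tau <= 2 ->
             eventually_O (fun k => enorm (x k - xs))
               (fun k => k%:R `^ (- ((tau - 1) / tau * (q - 1) - 1))),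
             2 < tau -> q < 2 * (tau - 1) / (tau - 2) ->
             eventually_O (fun k => enorm (x k - xs))
               (fun k => k%:R `^ (- ((tau - 1) / tau * (q - 1) - 1)))
           & 2 < tau -> 2 * (tau - 1) / (tau - 2) <= q ->
             eventually_O (fun k => enorm (x k - xs))
               (fun k => k%:R `^ (- (q / 2 - 1)))])
    & (* (iii) *)
      1 / 2 < theta ->
      (forall zeta : R, 0 < zeta < 1 -> 0 < eps 0%N ->
         (forall k, eps k = eps 0%N * zeta ^+ k) ->
         eventually_O (fun k => enorm (x k - xs))
           (fun k => k%:R `^ (- ((1 - theta) / (2 * theta - 1)))))
      /\
      (forall q : R, (2 * tau - 1) / (tau - 1) < q -> 0 < eps 0%N ->
         (forall k, eps k = eps 0%N / (k.+1%:R `^ q)) ->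
         (* (b1) *)
         (tau <= 2 \/ (2 < tau /\ q < 2 * (tau - 1) / (tau - 2)) ->
            (q < tau / (tau - 1) * (theta / (2 * theta - 1)) + 1 ->
             eventually_O (fun k => enorm (x k - xs))
               (fun k => k%:R `^ (- ((tau - 1) / tau * (q - 1) - 1))))
            /\
            (tau / (tau - 1) * (theta / (2 * theta - 1)) + 1 <= q ->
             eventually_O (fun k => enorm (x k - xs))
               (fun k => k%:R `^ (- ((1 - theta) / (2 * theta - 1))))))
         /\
         (* (b2) *)
         (2 < tau -> 2 * (tau - 1) / (tau - 2) <= q ->
            (q < 2 * theta / (2 * theta - 1) ->
             eventually_O (fun k => enorm (x k - xs))
               (fun k => k%:R `^ (- (q / 2 - 1))))
            /\
            (2 * theta / (2 * theta - 1) <= q ->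
             eventually_O (fun k => enorm (x k - xs))
               (fun k => k%:R `^ (- ((1 - theta) / (2 * theta - 1)))))))].
Proof.
move: hgam => [hgam0 _].
have tau0 : 0 < tau := lt_trans ltr01 htau.
have y_grad k : y k = grad g (x k).
  apply: subgradient_grad (y_subgradient hx k); apply: hg_diff.
  exact: (run_Omega hx).
have step k : exists2 d, eps_subdiff (delta k) f (x k.+1) d &
    Delta k = d + grad h (x k) - Fval f h g (x k) *: y k + (x k.+1 - x k) *m H k.
  have [d d1 d2] := x_step hx k; exists d => //.
  by have [sH _] := H_posdef hx k; rewrite sH in d2.
have h_up := descent_lemma (h_differentiable hA) (h_grad_lipschitz hA).
have Phi_sub u d t : Omega g u -> eps_subdiff 0 f u d -> 0 <= t ->
  frechet_subdiff (Phi f h g tau) (pt u t)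
    (pt ((g u)^-1 *: (d + grad h u - Fval f h g u *: grad g u)) (t `^ (tau - 1))).
  by move=> gu du t0; exact: (Phi_frechet hA htau gu (hg_diff _ gu) du t0).
have delta0 : exists K0, forall k, (K0 <= k)%N -> delta k = 0.
  by have [K0 [_ ?]] := hdelta; exists K0.
have h_lip := h_grad_lipschitz hA.
(* From here on the gradients are generalized to functions with these properties. *)
move: (grad h) (grad g) h_up h_lip step y_grad Phi_sub hg_lip {hg_C1} =>
  dh dg h_up h_lip step y_grad Phi_sub dg_lip.
have [r0 [E0 M0]] := series_majorants htau (eps_ge0 hx) hsum hsum_sqrt hsum_tail.
have [xs cl] := run_cluster hA hx hgam_Lh hH h_up step (maj_r_ge0 M0) (maj_r_dec M0).
have [_ gxs _] := run_cluster_point hA hx hgam_Lh hH h_up step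
  (maj_r_ge0 M0) (maj_r_dec M0) (maj_r_cvg0 M0) cl hf_lip.
pose dist k := enorm (x k - xs); pose s k := enorm (x k.+1 - x k).
have KL r E : error_majorants eps tau r E -> exists A sigma C rho K,
    kl_descent dist s (fun k => Num.sqrt (eps k) + r k.+1 `^ (1 - tau^-1)) A
      theta sigma C rho K.
  move=> M; eexists.
  exact: (run_kl_descent hA hx hgam0 hgam_Lh hgam_le hH h_up h_lip y_grad step
    (maj_r_ge0 M) (maj_r_dec M) (maj_r_cvg0 M) cl hf_lip htau (dg_lip _ gxs) Phi_sub
    delta0 (maj_error_cvg0 M) hKL).
have [A0 [sigma0 [C0 [rho0 [K0 D0]]]]] := KL _ _ M0.
have dist_cvg0 : dist k @[k --> \oo] --> 0.
  pose th := Num.max theta (1 / 2).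
  have th01 : 0 < th < 1.
    by case/andP: htheta => ? ?; rewrite lt_max gt_max; apply/andP; split; lra.
  have thth : theta <= th by rewrite le_max lexx.
  have [K1 D1] := kl_descent_weaken thth D0.
  exact: (kl_cvg D1 th01 (maj_E_ge0 M0) (maj_E_dec M0) (maj_E_cvg0 M0)).
have poly p r E Ce CE : 1 < p -> p * (2 * theta - 1) <= theta ->
    error_majorants eps tau r E ->
    (forall k, Num.sqrt (eps k) + r k.+1 `^ (1 - tau^-1) <= Ce * k.+1%:R `^ (- p)) ->
    (forall k, E k <= CE * k.+1%:R `^ (- (p - 1))) ->
    eventually_O dist (fun k => k%:R `^ (- (p - 1))).
  move=> p1 pth M eb Eb; have [A [sigma [C [rho [K D]]]]] := KL _ _ M.
  exact: (kl_poly_rate_le p1 pth D (maj_E_ge0 M) (maj_E_dec M) (maj_E_cvg0 M) eb Eb).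
have poly_eps q p : 0 < eps 0%N -> (forall k, eps k = eps 0%N / (k.+1%:R `^ q)) ->
    1 < p -> p <= q / 2 -> p <= (tau - 1) / tau * (q - 1) ->
    p * (2 * theta - 1) <= theta ->
    eventually_O dist (fun k => k%:R `^ (- (p - 1))).
  move=> e0 epsE p1 pq1 pq2 pth.
  have pq3 : p <= (q - 1) * (1 - tau^-1).
    by have -> : 1 - tau^-1 = (tau - 1) / tau; [field; rewrite gt_eqF|rewrite mulrC].
  have [r [E [Ce [CE [M eb Eb]]]]] := poly_majorants htau e0 epsE p1 pq1 pq3.
  exact: (poly _ _ _ _ _ p1 pth M eb Eb).
(* The exponents of the error terms: [(tau - 1) / tau * (q - 1)] for the tails and
   [q / 2] for the square roots; the smaller one decides. *)
have tail_gt1 q : (2 * tau - 1) / (tau - 1) < q -> 1 < (tau - 1) / tau * (q - 1).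
  have t1 : 0 < tau - 1 by lra.
  rewrite ltr_pdivrMr// => hq; rewrite mulrAC ltr_pdivlMr//; lra.
have tail_le q : (2 * tau - 1) / (tau - 1) < q ->
    tau <= 2 \/ (2 < tau /\ q < 2 * (tau - 1) / (tau - 2)) ->
    (tau - 1) / tau * (q - 1) <= q / 2.
  have t1 : 0 < tau - 1 by lra.
  rewrite ltr_pdivrMr// => hq hcase.
  have qt : q * (tau - 2) <= 2 * (tau - 1).
    case: hcase => [t2|[t2]]; last by rewrite ltr_pdivlMr; lra.
    have q0 : 0 <= q.
      by rewrite leNgt; apply/negP => qn; have := ltr_pM2r t1 q 0; rewrite qn mul0r => ?; lra.
    by have := mulr_ge0 q0 (_ : 0 <= 2 - tau); lra.
  rewrite mulrAC ler_pdivrMr//; lra.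
have sqrt_le q : 2 < tau -> 2 * (tau - 1) / (tau - 2) <= q ->
    1 < q / 2 /\ q / 2 <= (tau - 1) / tau * (q - 1).
  move=> t2; rewrite ler_pdivrMr ?subr_gt0// => hq; split.
    have : 2 * (tau - 2) < q * (tau - 2) by lra.
    by rewrite ltr_pM2r ?subr_gt0//; lra.
  rewrite [leRHS]mulrAC ler_pdivlMr//; lra.
exists xs.
  apply: cvg_enorm => d d0; have /cvgr0Pnorm_lt/(_ _ d0) := dist_cvg0.
  by apply: filterS => k; exact/le_lt_trans/ler_norm.
split.
- move=> th0; rewrite th0 in D0.
  have := kl_finite D0 dist_cvg0 (maj_error_cvg0 M0); apply: filterS => k.
  by move=> /enorm0_eq0/eqP; rewrite subr_eq0 => /eqP.
- move=> /andP[th0 th2].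
  have thp p : 1 < p -> p * (2 * theta - 1) <= theta.
    move=> p1; have : p * (1 - 2 * theta) >= 0 by rewrite mulr_ge0; lra.
    lra.
  split.
    move=> zeta z01 e0 epsE.
    have [z [r [E [Ce [CE [z01' _ _ [M eb Eb]]]]]]] :=
      geometric_majorants htau z01 e0 epsE.
    have [A [sigma [C [rho [K D]]]]] := KL _ _ M.
    have [K1 D1] := kl_descent_weaken th2 D.
    exact: (kl_geometric_rate z01' D1 (maj_E_ge0 M) (maj_E_dec M) (maj_E_cvg0 M) eb Eb).
  move=> q hq e0 epsE; have p1 := tail_gt1 _ hq; split.
  + move=> t2; apply: (poly_eps q) => //; last exact: thp.
    by apply: tail_le => //; left.
  + move=> t2 hq2; apply: (poly_eps q) => //; last exact: thp.
    by apply: tail_le => //; right.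
  + move=> t2 hq2; have [p2 p3] := sqrt_le _ t2 hq2.
    by apply: (poly_eps q) => //; exact: thp.
- move=> th2; have d0 : 0 < 2 * theta - 1 by lra.
  have th1 : theta < 1 by case/andP: htheta.
  pose pc := theta / (2 * theta - 1).
  have pc1 : 1 < pc by rewrite /pc ltr_pdivlMr//; lra.
  have pcE : (1 - theta) / (2 * theta - 1) = pc - 1.
    by rewrite /pc; field; rewrite gt_eqF.
  have pcth p : p <= pc -> p * (2 * theta - 1) <= theta by rewrite ler_pdivlMr.
  rewrite pcE; split.
    move=> zeta z01 e0 epsE.
    have [z [r [E [Ce [CE [z01' Ce0 CE0 [M eb Eb]]]]]]] :=
      geometric_majorants htau z01 e0 epsE.
    have [G1 _ HG1] := geometric_le_powR z01' (lt_trans ltr01 pc1).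
    have pc0 : 0 < pc - 1 by rewrite subr_gt0.
    have [G2 _ HG2] := geometric_le_powR z01' pc0.
    apply: (poly pc r E (Ce * G1) (CE * G2)) => //; first exact: pcth.
      by move=> k; apply: le_trans (eb k) _; rewrite -mulrA ler_wpM2l.
    by move=> k; apply: le_trans (Eb k) _; rewrite -mulrA ler_wpM2l.
  move=> q hq e0 epsE; have p1 := tail_gt1 _ hq.
  have t1 : 0 < tau - 1 by lra.
  have tailE p : (tau / (tau - 1) * p + 1 <= q) = (p <= (tau - 1) / tau * (q - 1)).
    rewrite -lerBrDr -[tau / (tau - 1)]invf_div mulrC ler_pdivrMr ?divr_gt0//.
    by rewrite mulrC.
  split.
    move=> hcase; have p2 := tail_le _ hq hcase; split.
      rewrite ltNge tailE -ltNge => hp.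
      by apply: (poly_eps q) => //; apply: pcth; exact: ltW.
    rewrite tailE => hp; apply: (poly_eps q) => //; last exact: pcth.
    exact: le_trans hp p2.
  move=> t2 hq2; have [p2 p3] := sqrt_le _ t2 hq2.
  have qE : 2 * theta / (2 * theta - 1) = 2 * pc by rewrite mulrA.
  rewrite qE; split=> hp.
    by apply: (poly_eps q) => //; apply: pcth; lra.
  apply: (poly_eps q) => //; [lra|apply: le_trans p3; lra|exact: pcth].
Qed.
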